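(* Let $(M,g)$ be a closed (compact, without boundary) oriented Riemannian manifold of dimension $n$, with Riemannian volume form $dV_g$, and let $f:M\to\mathbb{R}$ be a smooth function with a single maximum, attained at $p_0\in M$, this maximum being non-degenerate. Then $$\lim_{N\to\infty}\frac{\int_{M} e^{Nf}\,dV_g}{\left(\frac{2\pi}{N}\right)^{n/2}e^{Nf(p_0)}\,\frac{\sqrt{\det(g_{p_0})}}{\sqrt{\det(-\mathrm{Hess}_{p_0}(f))}}\left[1+\frac{1}{6N}\mathrm{tr}\left(\mathrm{Hess}_{p_0}(f)^{-1}R_{p_0}\right)\right]}=1,$$ where $R_{p_0}$ denotes the Ricci tensor of $g$ at $p_0$.
   Context: $\mathrm{Hess}_{p_0}(f):T_{p_0}M\times T_{p_0}M\to\mathbb{R}$ is the bilinear form $\mathrm{Hess}_{p_0}(f)(X,Y)=\widetilde X\cdot(\widetilde Y\cdot f)(p_0)$, where $\widetilde X,\widetilde Y$ are arbitrary extensions of $X,Y$ to vector fields near $p_0$ (well defined since $p_0$ is a critical point of $f$). The maximum is non-degenerate if this form is non-degenerate. The determinants $\det(g_{p_0})$ and $\det(-\mathrm{Hess}_{p_0}(f))$ are those of the matrices of these bilinear forms in the same, arbitrary, local coordinates at $p_0$ (the quotient is coordinate independent). In such coordinates, $\mathrm{tr}(\mathrm{Hess}_{p_0}(f)^{-1}R_{p_0})=\sum_{i,j}(H^{-1})^{ij}R_{ij}$, with $H$ the matrix of $\mathrm{Hess}_{p_0}(f)$ and $R_{ij}$ the components of the Ricci tensor at $p_0$. *)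

(* Defs.v *)
From HB Require Import structures.
From mathcomp Require Import all_boot all_order all_algebra.
From mathcomp Require Import all_classical all_reals all_analysis.

Set Implicit Arguments.
Unset Strict Implicit.
Unset Printing Implicit Defensive.

Import Order.TTheory GRing.Theory Num.Theory.
Import numFieldNormedType.Exports.

Local Open Scope classical_set_scope.
Local Open Scope ring_scope.

(* The library proves that the product of two sigma-finite measures is
   sigma-finite, but the corresponding canonical instance on [\x] is not
   reachable from outside; it is redeclared here on an alias. *)

Section ProductMeasure.
Local Open Scope ereal_scope.
Context d1 d2 (T1 : measurableType d1) (T2 : measurableType d2) (R : realType).
Variable m1 : {sigma_finite_measure set T1 -> \bar R}.
Variable m2 : {sigma_finite_measure set T2 -> \bar R}.

Definition prod_measure : set (T1 * T2) -> \bar R := m1 \x m2.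

HB.instance Definition _ := Measure.on prod_measure.

Let prod_measure_sigma_finite : sigma_finite setT prod_measure.
Proof.
have /sigma_finiteP[F [TF ndF Foo]] := sigma_finiteT m1.
have /sigma_finiteP[G [TG ndG Goo]] := sigma_finiteT m2.
exists (fun n => F n `*` G n).
  rewrite -setXTT TF TG predeqE => -[x y]; split.
    move=> [/= [n _ Fnx] [k _ Gky]]; exists (maxn n k) => //; split.
    - by move: x Fnx; exact/subsetPset/ndF/leq_maxl.
    - by move: y Gky; exact/subsetPset/ndG/leq_maxr.
  by move=> [n _ []/= ? ?]; split; exists n.
move=> k; have [? ?] := Foo k; have [? ?] := Goo k.
split; first exact: measurableX.
by rewrite /prod_measure product_measure1E// lte_mul_pinfty// ge0_fin_numE.
Qed.

HB.instance Definition _ := Measure_isSigmaFinite.Build _ _ _ prod_measure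
  prod_measure_sigma_finite.

End ProductMeasure.

(* R^n with Lebesgue measure: the iterated product R * (R * ... * unit),
   identified with row vectors by [euclid_row]. *)

Section Euclidean.
Variable R : realType.

Fixpoint euclid_sig (n : nat) : {d & measurableType d} :=
  if n is m.+1 then
    existT (fun d => measurableType d) _
      (measurableTypeR R * projT2 (euclid_sig m) : measurableType _)%type
  else existT (fun d => measurableType d) _ (unit : measurableType _).

Definition euclid (n : nat) := projT2 (euclid_sig n).

Fixpoint lebesgue_euclid (n : nat) :
    {sigma_finite_measure set (euclid n) -> \bar R} :=
  match n return {sigma_finite_measure set (euclid n) -> \bar R} with
  | 0 => \d_tt
  | m.+1 => prod_measure lebesgue_measure (lebesgue_euclid m)
  end.

Fixpoint euclid_row (n : nat) : euclid n -> 'rV[R]_n :=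
  match n return euclid n -> 'rV[R]_n with
  | 0 => fun=> 0
  | m.+1 => fun x => row_mx (const_mx x.1 : 'rV_1) (euclid_row x.2)
  end.

Definition integral_rV (n : nat) (F : 'rV[R]_n -> R) : R :=
  \int[lebesgue_euclid n]_x F (euclid_row x).

End Euclidean.

Section Smooth.
Context {R : realType} {n : nat}.
Implicit Types (F : 'rV[R]_n -> R) (x : 'rV[R]_n).

Definition unit_row (i : 'I_n) : 'rV[R]_n := delta_mx 0 i.

Definition partial (i : 'I_n) F : 'rV[R]_n -> R := fun x => 'D_(unit_row i) F x.

Definition iter_partial (s : seq 'I_n) F : 'rV[R]_n -> R := foldr partial F s.

(* C^oo on a neighbourhood of [x]: all iterated partial derivatives exist and
   are continuous there. *)
Definition smooth_near F x : Prop :=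
  \forall y \near x, forall s : seq 'I_n,
    {for y, continuous (iter_partial s F)} /\
    forall i, derivable (iter_partial s F) y (unit_row i).

End Smooth.

(* Charts of a topological space [M] with values in R^n: [cfun] restricts to a
   homeomorphism from the open set [cdom] onto an open subset of R^n, with
   inverse [cinv]; outside these sets the values are irrelevant. *)
Record chart (R : realType) (M : topologicalType) (n : nat) := Chart {
  cdom : set M;
  cfun : M -> 'rV[R]_n;
  cinv : 'rV[R]_n -> M;
  cdom_open : open cdom;
  cran_open : open (cfun @` cdom);
  cfunK : forall p, cdom p -> cinv (cfun p) = p;
  cfun_continuous : forall p, cdom p -> {for p, continuous cfun};
  cinv_continuous : forall p, cdom p -> {for cfun p, continuous cinv} }.

Section Compatibility.
Context {R : realType} {M : topologicalType} {n : nat}.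
Implicit Types c : chart R M n.

Definition transition c c' : 'rV[R]_n -> 'rV[R]_n := cfun c' \o cinv c.

Definition compatible c c' : Prop := forall p, cdom c p -> cdom c' p ->
  forall i, smooth_near (fun x => transition c c' x 0 i) (cfun c p) /\
            smooth_near (fun x => transition c' c x 0 i) (cfun c' p).

Definition same_orientation c c' : Prop := forall p, cdom c p -> cdom c' p ->
  0 < \det ('J (transition c c') (cfun c p)).

End Compatibility.

(* A smooth structure together with an orientation on [M], given by an
   oriented atlas: the local coordinates are all the charts compatible with
   the atlas (see [local_chart]), and the charts of the atlas itself are
   positively oriented. *)
Record oriented_atlas (R : realType) (M : topologicalType) (n : nat) :=
  OrientedAtlas {
  atlas : set (chart R M n);
  atlas_cover : forall p, exists2 c, atlas c & cdom c p;
  atlas_compatible : forall c c', atlas c -> atlas c' -> compatible c c';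
  atlas_oriented : forall c c', atlas c -> atlas c' -> same_orientation c c' }.

Section Manifold.
Context {R : realType} {M : topologicalType} {n : nat}.
Variable A : oriented_atlas R M n.
Implicit Types (c : chart R M n) (p q : M) (f h : M -> R).

Definition local_chart c p : Prop :=
  cdom c p /\ forall c', atlas A c' -> compatible c c'.

Definition smooth_at h p : Prop :=
  forall c, local_chart c p -> smooth_near (h \o cinv c) (cfun c p).

Definition smooth h : Prop := forall p, smooth_at h p.

(* Tangent vectors at [p] are the directional derivatives at [p], acting on
   the functions that are smooth near [p]; they are extended by 0 to the other
   functions, so that equality of tangent vectors is equality of functions. *)
Definition tvec : Type := (M -> R) -> R.

Definition tvec0 : tvec := fun=> 0.

Definition coord_vec c p (a : 'rV[R]_n) : tvec := fun h =>
  if `[< smooth_at h p >] then 'D_a (h \o cinv c) (cfun c p) else 0.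

Definition tangent p (X : tvec) : Prop :=
  exists c (a : 'rV[R]_n), local_chart c p /\ X = coord_vec c p a.

Definition coord_frame c p (i : 'I_n) : tvec := coord_vec c p (unit_row i).

Definition vector_field_near p (X : M -> tvec) : Prop :=
  (\forall q \near p, tangent q (X q)) /\
  forall h, smooth_at h p -> smooth_at (fun q => X q h) p.

Definition form_mx c p (B : tvec -> tvec -> R) : 'M[R]_n :=
  \matrix_(i, j) B (coord_frame c p i) (coord_frame c p j).

Definition nondegenerate_at p (B : tvec -> tvec -> R) : Prop :=
  forall X, tangent p X -> (forall Y, tangent p Y -> B X Y = 0) -> X = tvec0.

(* For X, Y tangent at [p], the value X~(Y~ f)(p) common to all the extensions
   X~, Y~ of X, Y to vector fields near [p]; it is 0 by convention if the value
   depends on the extensions, which happens only if [p] is not critical. *)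
Definition hess f p (X Y : tvec) : R :=
  xget 0 [set r | forall X' Y' : M -> tvec,
    vector_field_near p X' -> vector_field_near p Y' ->
    X' p = X -> Y' p = Y -> r = X' p (fun q => Y' q f)].

Record riemannian_metric := RiemannianMetric {
  metric :> M -> tvec -> tvec -> R;
  metric_linear : forall p (a : R) X Y Z,
    tangent p X -> tangent p Y -> tangent p Z ->
    metric p (fun h => a * X h + Y h) Z = a * metric p X Z + metric p Y Z;
  metric_sym : forall p X Y,
    tangent p X -> tangent p Y -> metric p X Y = metric p Y X;
  metric_gt0 : forall p X, tangent p X -> X <> tvec0 -> 0 < metric p X X;
  metric_smooth : forall c p i j, local_chart c p ->
    smooth_at (fun q => metric q (coord_frame c q i) (coord_frame c q j)) p }.

Section Curvature.
Variables (g : riemannian_metric) (c : chart R M n).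
Implicit Types i j k l m : 'I_n.

Definition metric_coord (x : 'rV[R]_n) : 'M[R]_n :=
  form_mx c (cinv c x) (g (cinv c x)).

(* Gamma^k_ij *)
Definition christoffel k i j (x : 'rV[R]_n) : R :=
  2^-1 * \sum_l invmx (metric_coord x) k l *
    (partial i (fun y => metric_coord y j l) x +
     partial j (fun y => metric_coord y i l) x -
     partial l (fun y => metric_coord y i j) x).

(* the component on d_l of R(d_i, d_j) d_k, where
   R(X, Y) Z = D_X D_Y Z - D_Y D_X Z - D_[X, Y] Z and D is the Levi-Civita
   connection *)
Definition riemann_coord l i j k (x : 'rV[R]_n) : R :=
  partial i (christoffel l j k) x - partial j (christoffel l i k) x +
  \sum_m (christoffel l i m x * christoffel m j k x -
          christoffel l j m x * christoffel m i k x).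

(* Ric(Y, Z) is the trace of X |-> R(X, Y) Z, hence is positive on round
   spheres. *)
Definition ricci_mx p : 'M[R]_n :=
  \matrix_(j, k) \sum_i riemann_coord i i j k (cfun c p).

End Curvature.

Definition nform : Type := M -> ('I_n -> tvec) -> R.

Definition positive_frame p (v : 'I_n -> tvec) : Prop :=
  exists c (B : 'M[R]_n), [/\ atlas A c, cdom c p, 0 < \det B &
    forall i, v i = coord_vec c p (row i B)].

(* dV_g(v_1, ..., v_n) is the square root of the Gram determinant, signed by
   the orientation. *)
Definition volume_form (g : riemannian_metric) : nform := fun p v =>
  let vol := Num.sqrt (\det (\matrix_(i, j) g p (v i) (v j))) in
  if `[< positive_frame p v >] then vol else - vol.

Record partition_of_unity := PartitionOfUnity {
  pu_size : nat;
  pu_chart : 'I_pu_size -> chart R M n;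
  pu_fun : 'I_pu_size -> M -> R;
  pu_chart_atlas : forall i, atlas A (pu_chart i);
  pu_fun_smooth : forall i, smooth (pu_fun i);
  pu_fun_ge0 : forall i p, 0 <= pu_fun i p;
  pu_fun_sum1 : forall p, \sum_i pu_fun i p = 1;
  pu_fun_support : forall i,
    closure [set p | pu_fun i p != 0] `<=` cdom (pu_chart i) }.

(* The integral of an n-form whose support is contained in the domain of the
   positively oriented chart [c] *)
Definition chart_integral c (w : nform) : R :=
  integral_rV (fun x => if `[< (cfun c @` cdom c) x >]
                        then w (cinv c x) (coord_frame c (cinv c x)) else 0).

(* The integral of a continuous n-form over a compact oriented manifold,
   computed with the partition of unity [P], on which its value does not
   depend. *)
Definition form_integral (P : partition_of_unity) (w : nform) : R :=
  \sum_i chart_integral (@pu_chart P i) (fun p v => @pu_fun P i p * w p v).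

End Manifold.

(* Main.v *)
From HB Require Import structures.
Require Import Defs.
From mathcomp Require Import all_boot all_order all_algebra.
From mathcomp Require Import all_classical all_reals all_analysis.
From mathcomp Require Import measurable_realfun ring lra.

(** Since the bracket tends to 1, only the leading order of Laplace's method is
    at stake. In a chart of the partition of unity the integrand is
    phi(x) e^(N psi(x)) with psi = f o c^-1 and phi continuous, supported in a
    compact set K. If the chart contains p0, then psi <= psi(x0) - e |x - x0|^2
    on all of K: near x0 because the Hessian is negative definite, away from x0
    by compactness and uniqueness of the maximum. Substituting
    x = x0 + y / sqrt N, dominated convergence reduces the integral to a
    Gaussian one, equal to phi(x0) sqrt((2 pi)^n / det(- Hess psi)). If the chart
    does not contain p0, its contribution is exponentially small. The ratio of
    the square roots of det g and det(- Hess f) at p0 does not depend on the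
    chart, so the limits add up through sum_i pu_i(p0) = 1. *)

Set Implicit Arguments.
Unset Strict Implicit.
Unset Printing Implicit Defensive.

Import Order.TTheory GRing.Theory Num.Theory.
Import numFieldNormedType.Exports.

Local Open Scope classical_set_scope.
Local Open Scope ring_scope.

(** * Differential calculus in R^n *)

(** Charts are never compared through their integrals. Each chart integral is evaluated on its own,
    and two charts meet only at [p0], where the matrices of the metric and of the Hessian change by
    congruence with the same Jacobian. The only substitutions made in integrals are therefore
    translations and dilations. The Gaussian integral is computed by splitting off one coordinate at
    a time with a Schur complement, which follows the recursive definition of Lebesgue measure on
    [euclid]. Definiteness of the Hessian has two sources: maximality makes it negative
    semidefinite, and nondegeneracy then excludes isotropic vectors. The inverse [cinv] of a chart
    is arbitrary outside the range of the chart, so [psi] is controlled only there. Global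
    continuity and measurability are proved for the product with the density, which vanishes off the
    compact set. *)

Lemma near_sub (T : topologicalType) (x : T) (P Q : T -> Prop) :
  (forall y, P y -> Q y) -> (\forall y \near x, P y) -> \forall y \near x, Q y.
Proof. by move=> PQ; apply: filterS. Qed.

Lemma near_all (T : topologicalType) (x : T) (P : T -> Prop) :
  (forall y, P y) -> \forall y \near x, P y.
Proof. by move=> aP; apply: nearW. Qed.

Lemma near_forall (T : topologicalType) (I : finType) (P : I -> T -> Prop) (x : T) :
  (forall i, \forall y \near x, P i y) -> \forall y \near x, forall i, P i y.
Proof. by move=> nP; apply: filter_forall. Qed.

Lemma near_and3 (T : topologicalType) (x : T) (P1 P2 P3 : T -> Prop) :
  (\forall y \near x, P1 y) -> (\forall y \near x, P2 y) ->
  (\forall y \near x, P3 y) -> \forall y \near x, [/\ P1 y, P2 y & P3 y].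
Proof. by move=> n1 n2 n3; near do split. Unshelve. all: by end_near. Qed.

Lemma near_eq_continuous_at (T U : topologicalType) (f g : T -> U) x :
  (\forall y \near x, f y = g y) -> {for x, continuous f} -> {for x, continuous g}.
Proof.
move=> fg cf; rewrite /prop_for /continuous_at -(nbhs_singleton fg).
by apply: cvg_trans cf; apply: (@near_eq_cvg _ _ (nbhs x)); apply: filterS fg.
Qed.

Lemma continuous_at_near (R : realType) (T : topologicalType) (f : T -> R) x e :
  {for x, continuous f} -> 0 < e -> \forall y \near x, `|f y - f x| < e.
Proof. by move=> /cvgrPdistC_lt; apply. Qed.

Lemma cvg_bigsum (R : realType) (T I : Type) (F : set_system T) {FF : Filter F}
    (r : seq I) (P : pred I) (f : I -> T -> R) (a : I -> R) :
  (forall i, P i -> f i x @[x --> F] --> a i) ->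
  \sum_(i <- r | P i) f i x @[x --> F] --> \sum_(i <- r | P i) a i.
Proof. by apply: cvg_big; exact: add_continuous. Qed.

Lemma cvg_bigprod (R : realType) (T I : Type) (F : set_system T) {FF : Filter F}
    (r : seq I) (P : pred I) (f : I -> T -> R) (a : I -> R) :
  (forall i, P i -> f i x @[x --> F] --> a i) ->
  \prod_(i <- r | P i) f i x @[x --> F] --> \prod_(i <- r | P i) a i.
Proof. by apply: cvg_big; exact: mul_continuous. Qed.

Section ContinuousAt.
Context {R : realType} {T : topologicalType}.
Implicit Types (f g : T -> R) (x : T).

Lemma continuous_at_cst (a : R) x : {for x, continuous (fun _ : T => a)}.
Proof. exact: (@cst_continuous T R a x). Qed.

Lemma continuous_atD f g x : {for x, continuous f} -> {for x, continuous g} ->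
  {for x, continuous (fun y => f y + g y)}.
Proof. by move=> cf cg; exact: (@continuousD R R T f g x). Qed.

Lemma continuous_atM f g x : {for x, continuous f} -> {for x, continuous g} ->
  {for x, continuous (fun y => f y * g y)}.
Proof. by move=> cf cg; exact: (@continuousM R T f g x). Qed.

Lemma continuous_at_sum I (r : seq I) (P : pred I) (f : I -> T -> R) x :
  (forall i, P i -> {for x, continuous (f i)}) ->
  {for x, continuous (fun y => \sum_(i <- r | P i) f i y)}.
Proof. by move=> cf; apply: (@cvg_bigsum _ _ _ (nbhs x)). Qed.

Lemma continuous_at_prod I (r : seq I) (P : pred I) (f : I -> T -> R) x :
  (forall i, P i -> {for x, continuous (f i)}) ->
  {for x, continuous (fun y => \prod_(i <- r | P i) f i y)}.
Proof. by move=> cf; apply: (@cvg_bigprod _ _ _ (nbhs x)). Qed.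

End ContinuousAt.

(** The open set [D] and the open complement of [K] cover the space, and [phi] is locally zero on
    the latter. This is what makes a density extended by zero continuous. *)
Lemma continuous_open_closed {R : realType} (T : topologicalType) (phi : T -> R)
    (D K : set T) : open D -> closed K -> K `<=` D ->
  (forall x, D x -> {for x, continuous phi}) -> (forall x, ~ K x -> phi x = 0) ->
  continuous phi.
Proof.
move=> oD cK KD cphi phi0 x; have [Dx|nDx] := pselect (D x); first exact: cphi.
have nKx : ~ K x by move=> /KD.
have nK : \forall y \near x, ~ K y.
  by apply: open_nbhs_nbhs; split=> //; exact: closed_openC.
apply: (@near_eq_continuous_at _ _ (fun=> 0)); last exact: continuous_at_cst.
by apply: near_sub nK => y /phi0.
Qed.

Lemma continuous_det {R : realType} (T : topologicalType) n (F : T -> 'M[R]_n) x :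
  (forall i j, {for x, continuous (fun y => F y i j)}) ->
  {for x, continuous (fun y => \det (F y))}.
Proof.
move=> cF; apply: continuous_at_sum => s _; apply: continuous_atM.
  exact: continuous_at_cst.
by apply: continuous_at_prod => i _; exact: cF.
Qed.

(** * Derivatives along lines and the mean value theorem *)

Section LineDerivative.
Context {R : realType} {V : normedModType R}.
Implicit Types (F : V -> R) (x v : V).

Lemma line_growth_rate F x v t :
  (fun h : R => h^-1 *: ((F \o shift (x + t *: v)) (h *: v) - F (x + t *: v))) =
  (fun h : R => h^-1 *: (((fun s => F (x + s *: v)) \o shift t) (h *: (1 : R)) -
                         F (x + t *: v))).
Proof.
apply/funext => h /=; congr (_ *: (F _ - _)).
by rewrite [h *: 1]mulr1 addrCA -scalerDl.
Qed.

(** Both difference quotients are the same function of the increment, so one-variable theorems apply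
    under mere directional derivability. *)
Lemma is_derive_line F x v t df : is_derive (x + t *: v) v F df <->
  is_derive t 1 (fun s => F (x + s *: v)) df.
Proof.
by split=> -[D E]; constructor;
  rewrite /derivable /derive ?line_growth_rate -?line_growth_rate in D E *.
Qed.

(** Homogeneity in the direction for a function known to be derivable along [v] only: it is the
    one-variable chain rule for the multiplication by [c], which covers c = 0 as well. *)
Lemma is_derive_dirZ F x v c df :
  is_derive x v F df -> is_derive x (c *: v) F (c * df).
Proof.
move=> D; rewrite -[x](addr0 x) -(scale0r (c *: v)); apply/is_derive_line.
have -> : (fun s => F (x + s *: (c *: v))) =
          (fun s => F (x + s *: v)) \o ( *:%R c).
  by apply/funext => s /=; rewrite !scalerA [_ *: s]mulrC.
have D' : is_derive (c *: (0 : R)) 1 (fun s => F (x + s *: v)) df.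
  by apply/is_derive_line; rewrite scaler0 scale0r addr0.
have := @is_derive1_comp R (fun s => F (x + s *: v)) ( *:%R c) 0 df c.
rewrite mulrC; apply => //.
by apply: is_derive_eq; rewrite [_ *: _]mulr1.
Qed.

Lemma mvt_line F x v :
  (forall t : R, 0 <= t <= 1 -> derivable F (x + t *: v) v) ->
  exists2 t : R, 0 < t < 1 & F (x + v) - F x = 'D_v F (x + t *: v).
Proof.
move=> dF; pose g s := F (x + s *: v).
have dg (t : R) : 0 <= t <= 1 -> is_derive t 1 g ('D_v F (x + t *: v)).
  by move=> /dF ?; apply/is_derive_line; apply: DeriveDef.
have [|||t] := @MVT R g (fun t => 'D_v F (x + t *: v)) 0 1 => //.
- by move=> t; rewrite in_itv /= => /andP[? ?]; apply: dg; lra.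
- apply: derivable_within_continuous => t; rewrite in_itv /= => tI.
  by have [] := dg t tI.
- rewrite in_itv /= => tI; rewrite /g scale1r scale0r addr0 subr0 mulr1 => E.
  by exists t.
Qed.

End LineDerivative.

(** * Functions with continuous partial derivatives *)

Section C1.
Context {R : realType} {n : nat}.
Implicit Types (F : 'rV[R]_n -> R) (x y z : 'rV[R]_n).

Lemma ball_rVP x (r : R) y : 0 < r ->
  ball x r y <-> forall i, `|y 0 i - x 0 i| < r.
Proof.
move=> r0; split=> [[_ B] i|B]; first by rewrite distrC; apply: B.
by split=> // i j; rewrite (ord1 i) /ball /= distrC.
Qed.

Lemma ler_coord_norm x i : `|x 0 i| <= `|x|.
Proof. by rewrite {2}/Num.norm /= mx_normrE (le_bigmax _ _ (0, i)). Qed.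

Lemma mean_value_inequality F x (r e : R) : 0 < r ->
  (forall y, ball x r y -> forall i,
     derivable F y (unit_row i) /\ `|partial i F y| <= e) ->
  forall y, ball x r y -> `|F y - F x| <= n%:R * e * `|y - x|.
Proof.
move=> r0 dF y yr.
(* [w k] has its first k coordinates from [y] and the others from [x], so the increment telescopes
   into moves along one axis each. The ball is that of the maximum norm, so all these segments stay
   inside. *)
pose w (k : nat) : 'rV[R]_n := \row_j (if (j < k)%N then y 0 j else x 0 j).
have wn : w n = y by apply/rowP => j; rewrite mxE ltn_ord.
have w0 : w 0%N = x by apply/rowP => j; rewrite mxE.
rewrite -{1}wn -[X in F _ - F X]w0 -(@telescope_sumr _ 0 n (F \o w))// big_mkord.
apply: le_trans (ler_norm_sum _ _ _) _.
rewrite -mulrA -[n in n%:R]card_ord mulr_natl -sumr_const.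
apply: ler_sum => k _.
have wS : w k.+1 = w k + (y 0 k - x 0 k) *: unit_row k.
  apply/rowP => j; rewrite !mxE eqxx/= ltnS leq_eqVlt val_eqE.
  have [->|jk] := eqVneq j k; first by rewrite ltnn mulr1 addrC subrK.
  by rewrite mulr0 addr0.
have wball t : 0 <= t <= 1 ->
    ball x r (w k + t *: ((y 0 k - x 0 k) *: unit_row k)).
  move=> /andP[t0 t1]; apply/ball_rVP => // j; rewrite !mxE eqxx /=.
  move/ball_rVP : yr => /(_ r0) yr.
  have [->|jk] := eqVneq j k.
    rewrite ltnn mulr1 [x 0 k + _]addrC addrK normrM ger0_norm//.
    by apply: le_lt_trans (yr k); rewrite ler_piMl.
  by rewrite !mulr0 addr0; case: ifP => _ //; rewrite subrr normr0.
have D t : 0 <= t <= 1 ->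
    is_derive (w k + t *: ((y 0 k - x 0 k) *: unit_row k))
      ((y 0 k - x 0 k) *: unit_row k) F ((y 0 k - x 0 k) *
        partial k F (w k + t *: ((y 0 k - x 0 k) *: unit_row k))).
  move=> tI; apply: is_derive_dirZ; apply: DeriveDef => //.
  by have [] := dF _ (wball _ tI) k.
rewrite /= wS; have [|t tI ->] := @mvt_line _ _ F (w k) ((y 0 k - x 0 k) *: unit_row k).
  by move=> t /D[].
have {}tI : 0 <= t <= 1 by lra.
have [_ ->] := D _ tI; rewrite normrM mulrC.
apply: ler_pM => //; first by have [] := dF _ (wball _ tI) k.
by have := ler_coord_norm (y - x) k; rewrite !mxE.
Qed.

Definition gradmx F x : 'cV[R]_n := \col_i partial i F x.

Definition difflin F x : 'rV[R]_n -> R := fun h => (h *m gradmx F x) 0 0.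

Lemma difflinE F x h : difflin F x h = \sum_i h 0 i * partial i F x.
Proof. by rewrite /difflin mxE; apply: eq_bigr => i _; rewrite !mxE. Qed.

Lemma difflin_is_linear F x : linear (difflin F x).
Proof. by move=> a u v; rewrite /difflin mulmxDl -scalemxAl !mxE. Qed.

HB.instance Definition _ F x := GRing.isLinear.Build R 'rV[R]_n R _
  (difflin F x) (difflin_is_linear F x).

Lemma is_derive_difflin F x y v : is_derive y v (difflin F x) (difflin F x v).
Proof.
have E h : (difflin F x \o shift y) (h *: v) - difflin F x y = h * difflin F x v.
  by rewrite /= linearD linearZ /= addrK.
have C : (fun h : R => h^-1 *: ((difflin F x \o shift y) (h *: v) - difflin F x y))
     h @[h --> 0^'] --> difflin F x v.
  apply: cvg_near_cst; near=> h.
  rewrite E -[_ *: _]/(_ * _) mulKf//.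
  near: h; exact: nbhs_dnbhs_neq.
by split; [apply/cvg_ex; exists (difflin F x v)|apply/cvg_lim].
Unshelve. all: by end_near. Qed.

Lemma continuous_difflin F x : continuous (difflin F x).
Proof.
have -> : difflin F x = (fun h => \sum_i h 0 i * partial i F x).
  by apply/funext => h; rewrite difflinE.
move=> h; apply: continuous_at_sum => i _.
by apply: continuous_atM; [exact: coord_continuous|exact: continuous_at_cst].
Qed.

(** The mean value inequality is applied to [F - difflin F x], whose partial derivatives vanish at
    [x], hence are small nearby by continuity. *)
Lemma C1_diff F x :
  (\forall y \near x, forall i, derivable F y (unit_row i)) ->
  (forall i, {for x, continuous (partial i F)}) ->
  differentiable F x /\ 'd F x = difflin F x :> ('rV[R]_n -> R).
Proof.
move=> dF cF.
suff o : F \o shift x = cst (F x) + difflin F x +o_ (0 : 'rV[R]_n) id.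
  have E := diff_unique (@continuous_difflin F x) o.
  split; last exact: E.
  by apply/diff_locallyP; rewrite E; split => //; exact: continuous_difflin.
apply/eqaddoP => _/posnumP[e].
(* The inequality costs a factor n; dividing by n + 1 covers dimension 0 too. *)
pose e' := e%:num / n.+1%:R.
have e'0 : 0 < e' by rewrite divr_gt0.
have : \forall y \near x, forall i, derivable F y (unit_row i) /\
    `|partial i F y - partial i F x| <= e'.
  near=> y => i; split; first by move: i; near: y.
  move: i; near: y; apply: filter_forall => i.
  by have /cvgrPdistC_le := cF i; apply.
move=> /nbhs_ballP[r /= r0 rB].
have {}rB y : ball x r y -> forall i, derivable (F - difflin F x) y (unit_row i) /\
    `|partial i (F - difflin F x) y| <= e'.
  move=> /rB yB i; have [dFy le] := yB i.
  have D : is_derive y (unit_row i) (F - difflin F x)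
      (partial i F y - difflin F x (unit_row i)).
    by apply: is_deriveB => //; exact: is_derive_difflin.
  split; first by case: D.
  rewrite /partial; have [_ ->] := D; rewrite difflinE (bigD1 i)//= big1.
    by rewrite !mxE !eqxx mul1r addr0.
  by move=> j ji; rewrite !mxE (negPf ji) andbF mul0r.
have H := mean_value_inequality r0 rB.
have B : \forall h \near (0 : 'rV[R]_n), ball x r (h + x).
  apply/nbhs_ballP; exists r => //= h; rewrite -!ball_normE /ball_ /=.
  by rewrite sub0r opprD addrCA subrr addr0.
near=> h.
have /H : ball x r (h + x) by near: h; exact: B.
have <- : (F - difflin F x) (h + x) - (F - difflin F x) x =
          (F \o shift x - (cst (F x) + difflin F x)) h.
  by rewrite !fctE /= (linearD (difflin F x)) /=; ring.
rewrite addrK => /le_trans; apply.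

rewrite ler_wpM2r// /e' mulrCA ler_piMr// ler_pdivrMr// mul1r.
by rewrite ler_nat.
Unshelve. all: by end_near. Qed.

End C1.

Section Chain.
Context {R : realType}.

Lemma derive_partial n (F : 'rV[R]_n -> R) x v : differentiable F x ->
  'D_v F x = \sum_j v 0 j * partial j F x.
Proof.
move=> dF; rewrite deriveE// {1}(row_sum_delta v) linear_sum.
apply: eq_bigr => j _; rewrite linearZ /= /partial deriveE//.
Qed.

Lemma differentiable_rV (V : normedModType R) m (T : V -> 'rV[R]_m) x :
  (forall j, differentiable (fun y => T y 0 j) x) -> differentiable T x.
Proof.
move=> dT.
have -> : T = \sum_(j < m) (fun y => T y 0 j *: (delta_mx 0 j : 'rV[R]_m)).
  by apply/funext => y; rewrite fct_sumE -row_sum_delta.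
by apply: differentiable_sum => j; apply: differentiableZl.
Qed.

Lemma is_derive_chain (V : normedModType R) m (F : 'rV[R]_m -> R)
    (T : V -> 'rV[R]_m) x v :
  differentiable F (T x) -> (forall j, differentiable (fun y => T y 0 j) x) ->
  is_derive x v (F \o T) (\sum_j 'D_v (fun y => T y 0 j) x * partial j F (T x)).
Proof.
move=> dF dTj; have dT := differentiable_rV dTj.
have dFT := differentiable_comp dT dF.
split; first exact: diff_derivable.
rewrite deriveE// diff_comp//= -deriveE// -[in LHS]deriveE// derive_partial//.
apply: eq_bigr => j _; rewrite derive_mx ?mxE//.
exact: diff_derivable.
Qed.

End Chain.

(** * Functions of class C^k on a set *)

Section Ck.
Context {R : realType} {n : nat}.
Implicit Types (F G : 'rV[R]_n -> R) (x : 'rV[R]_n) (U : set 'rV[R]_n).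

(** [smooth_near] quantifies over words of indices; recursion on the order gives inductive proofs
    for products and compositions. Derivability is a separate clause because [partial] has a value
    even where the limit does not exist. *)
Fixpoint Ck k U F : Prop :=
  (forall x, U x -> {for x, continuous F}) /\
  if k is k'.+1 then forall i,
    (forall x, U x -> derivable F x (unit_row i)) /\ Ck k' U (partial i F)
  else True.

Lemma Ck_continuous k U F x : Ck k U F -> U x -> {for x, continuous F}.
Proof. by case: k => [|k] [] + _; apply. Qed.

Lemma Ck_derivable k U F x i : Ck k.+1 U F -> U x -> derivable F x (unit_row i).
Proof. by move=> [_ /(_ i)[]] + _; apply. Qed.

Lemma Ck_partial k U F i : Ck k.+1 U F -> Ck k U (partial i F).
Proof. by move=> [_ /(_ i)[]]. Qed.

Lemma CkS k U F : Ck k.+1 U F -> Ck k U F.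
Proof.
elim: k F => [|k IH] F; first by case.
move=> [cF dF]; split=> // i; have [dFi CF] := dF i.
by split => //; apply: IH.
Qed.

Lemma Ck_sub k U U' F : U' `<=` U -> Ck k U F -> Ck k U' F.
Proof.
move=> UU; elim: k F => [|k IH] F /= [cF dF]; split=> //; first by move=> x /UU/cF.
  by move=> x /UU/cF.
by move=> i; have [dFi CF] := dF i; split; [move=> x /UU/dFi|apply: IH].
Qed.

Lemma open_near U x (P : 'rV[R]_n -> Prop) : open U -> U x ->
  (forall y, U y -> P y) -> \forall y \near x, P y.
Proof. by move=> oU Ux H; apply: filterS H _; exact: open_nbhs_nbhs. Qed.

Lemma eq_Ck k U F G : open U -> (forall x, U x -> F x = G x) ->
  Ck k U F -> Ck k U G.
Proof.
move=> oU; elim: k F G => [|k IH] F G FG /= [cF dF]; split=> //.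
- move=> x Ux; have nFG : \forall y \near x, F y = G y by apply: open_near oU Ux FG.
  exact: near_eq_continuous_at nFG (cF _ Ux).
- move=> x Ux; have nFG : \forall y \near x, F y = G y by apply: open_near oU Ux FG.
  exact: near_eq_continuous_at nFG (cF _ Ux).
- move=> i; have [dFi CF] := dF i; split.
    move=> x Ux; apply: near_eq_derivable (dFi _ Ux).
    exact: open_near oU Ux FG.
  apply: IH CF => x Ux; apply: near_eq_derive.
  exact: open_near oU Ux FG.
Qed.

Lemma Ck_cst k U (a : R) : Ck k U (fun _ => a).
Proof.
elim: k a => [|k IH] a /=; split=> //; try by move=> x _; exact: continuous_at_cst.
move=> i; split; first by move=> x _; exact: derivable_cst.
have -> : partial i (fun=> a) = (fun=> 0); last exact: IH.
by apply/funext => x; exact: derive_cst.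
Qed.

Lemma Ck_add k U F G : open U -> Ck k U F -> Ck k U G ->
  Ck k U (fun x => F x + G x).
Proof.
move=> oU; elim: k F G => [|k IH] F G /= [cF dF] [cG dG]; split => //.
- by move=> x Ux; apply: continuous_atD; [exact: cF|exact: cG].
- by move=> x Ux; apply: continuous_atD; [exact: cF|exact: cG].
move=> i; have [dFi CF] := dF i; have [dGi CG] := dG i; split.
  by move=> x Ux; apply: (@derivableD _ _ _ F G); [exact: dFi|exact: dGi].
apply: (eq_Ck oU _ (IH _ _ CF CG)) => x Ux.
by rewrite /partial -(@deriveD _ _ _ F G)//; [exact: dFi|exact: dGi].
Qed.

Lemma Ck_sum k U I (r : seq I) (F : I -> 'rV[R]_n -> R) : open U ->
  (forall i, Ck k U (F i)) -> Ck k U (fun x => \sum_(i <- r) F i x).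
Proof.
move=> oU CF; elim: r => [|i r IH].
  have -> : (fun x => \sum_(i <- [::]) F i x) = fun=> 0.
    by apply/funext => x; rewrite big_nil.
  exact: Ck_cst.
have -> : (fun x => \sum_(j <- i :: r) F j x) =
          fun x => F i x + \sum_(j <- r) F j x.
  by apply/funext => x; rewrite big_cons.
exact: Ck_add.
Qed.

Lemma Ck_mul k U F G : open U -> Ck k U F -> Ck k U G ->
  Ck k U (fun x => F x * G x).
Proof.
move=> oU; elim: k F G => [|k IH] F G CF CG; split => //=.
- move=> x Ux; apply: continuous_atM; first exact: Ck_continuous CF _.
  exact: Ck_continuous CG _.
- move=> x Ux; apply: continuous_atM; first exact: Ck_continuous CF _.
  exact: Ck_continuous CG _.
move=> i; split.
  by move=> x Ux; apply: (@derivableM _ _ F G);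
    [exact: Ck_derivable CF _|exact: Ck_derivable CG _].
apply: (eq_Ck oU _ (Ck_add oU (IH _ _ (CkS CF) (Ck_partial i CG))
  (IH _ _ (CkS CG) (Ck_partial i CF)))) => x Ux.
by apply/esym; apply: (@deriveM _ _ F G);
    [exact: Ck_derivable CF _|exact: Ck_derivable CG _].
Qed.

Lemma Ck1_diff U F x : open U -> Ck 1 U F -> U x -> differentiable F x.
Proof.
move=> oU CF Ux; have [] // := @C1_diff R n F x.
  by apply: open_near oU Ux _ => y Uy i; exact: Ck_derivable CF Uy.
by move=> i; apply: Ck_continuous (Ck_partial i CF) Ux.
Qed.

Lemma smooth_nearP F x : smooth_near F x <->
  exists U, [/\ open U, U x & forall k, Ck k U F].
Proof.
split.
  move=> sF; have := sF; rewrite {1}/smooth_near /prop_near1 nbhsE => -[U [oU Ux] UF].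
  exists U; split=> // k.
  have {}UF y : U y -> forall s : seq 'I_n,
    {for y, continuous (iter_partial s F)} /\
    forall i, derivable (iter_partial s F) y (unit_row i) by move/UF.
  elim: k F sF UF => [|k IH] F sF UF; split => //.
  - by move=> y /UF/(_ [::])[].
  - by move=> y /UF/(_ [::])[].
  move=> i; split; first by move=> y /UF/(_ [::])[].
  (* Under [foldr] the last index of a word is the innermost derivative, so passing from [F] to
     [partial i F] extends words by [rcons]. *)
  have E s : iter_partial s (partial i F) = iter_partial (rcons s i) F.
    by rewrite /iter_partial foldr_rcons.
  apply: IH; last by move=> y Uy s; rewrite E; exact: UF.
  by apply: filterS sF => y + s; rewrite E; apply.
move=> [U [oU Ux CF]]; apply: open_near oU Ux _ => y Uy s.
elim/last_ind: s F CF => [|s i IH] F CF.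
  split; first exact: Ck_continuous (CF 0%N) Uy.
  by move=> i; apply: Ck_derivable (CF 1%N) Uy.
rewrite /iter_partial foldr_rcons; apply: IH => k.
exact: Ck_partial (CF k.+1).
Qed.

End Ck.

Lemma continuous_at_rV {R : realType} (X : topologicalType) m
    (T : X -> 'rV[R]_m) x :
  (forall j, {for x, continuous (fun y => T y 0 j)}) -> {for x, continuous T}.
Proof.
move=> cT A /nbhs_ballP[e /= e0 eA].
suff : \forall y \near x, forall j, `|T y 0 j - T x 0 j| < e.
  by apply: filterS => y /(ball_rVP _ _ e0) /eA.
by apply: filter_forall => j; have /cvgrPdistC_lt := cT j; apply.
Qed.

(** By the chain rule each partial derivative is a sum of products with a factor [partial j F \o T];
    the induction hypothesis applies to it, with [T] taken one order lower. *)
Lemma Ck_comp {R : realType} {n m : nat} k (U : set 'rV[R]_n) (V : set 'rV[R]_m)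
    (T : 'rV[R]_n -> 'rV[R]_m) (F : 'rV[R]_m -> R) : open U -> open V ->
  (forall x, U x -> V (T x)) -> (forall j, Ck k U (fun x => T x 0 j)) ->
  Ck k V F -> Ck k U (F \o T).
Proof.
move=> oU oV UV; elim: k F => [|k IH] F CT CF.
  split=> // x Ux; apply: continuous_comp; last exact: Ck_continuous CF (UV _ Ux).
  by apply: continuous_at_rV => j; exact: Ck_continuous (CT j) Ux.
have CSk j : Ck k U (fun x => T x 0 j) by exact: CkS.
have Ck1 p q (W : set 'rV[R]_p) (G : 'rV[R]_p -> R) : Ck q.+1 W G -> Ck 1 W G.
  by elim: q => // q IHq /CkS.
have D x i : U x -> is_derive x (unit_row i) (F \o T)
    (\sum_j partial i (fun y => T y 0 j) x * partial j F (T x)).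
  move=> Ux; apply: is_derive_chain.
    exact: Ck1_diff oV (Ck1 _ _ _ _ CF) (UV _ Ux).
  by move=> j; exact: Ck1_diff oU (Ck1 _ _ _ _ (CT j)) Ux.
split=> [x Ux|i].
  apply: continuous_comp; last exact: Ck_continuous CF (UV _ Ux).
  by apply: continuous_at_rV => j; exact: Ck_continuous (CT j) Ux.
split; first by move=> x Ux; have [] := D x i Ux.
apply: (@eq_Ck _ _ _ _
    (fun x => \sum_j partial i (fun y => T y 0 j) x * (partial j F \o T) x)) => //.
  by move=> x Ux; have [_ /esym] := D x i Ux.
apply: Ck_sum => // j; apply: Ck_mul => //; first exact: Ck_partial.
by apply: IH => //; exact: Ck_partial CF.
Qed.

(** * Symmetry of second derivatives and Taylor's formula *)

Section SecondOrder.
Context {R : realType} {n : nat}.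
Implicit Types (F : 'rV[R]_n -> R) (x z : 'rV[R]_n) (U : set 'rV[R]_n).

Lemma is_derive_translate (V : normedModType R) (F : V -> R) (x c v : V) (df : R) :
  is_derive (x + c) v F df -> is_derive x v (fun y => F (y + c)) df.
Proof.
have E : (fun h : R => h^-1 *: ((F \o shift (x + c)) (h *: v) - F (x + c))) =
   (fun h : R => h^-1 *: (((fun y => F (y + c)) \o shift x) (h *: v) - F (x + c))).
  by apply/funext => h; rewrite /= addrA.
by move=> -[D1 D2]; constructor; [rewrite /derivable -E|rewrite /derive -E].
Qed.

(** The mean value theorem is used twice: along axis i for the increment [G] of [F] in direction j,
    then along axis j for [partial i F]. *)
Lemma second_difference U F x i j (t : R) : open U -> Ck 2 U F ->
  (forall a b : R, 0 <= a <= 1 -> 0 <= b <= 1 ->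
    U (x + a *: (t *: unit_row i) + b *: (t *: unit_row j))) ->
  exists a b : R, [/\ 0 <= a <= 1, 0 <= b <= 1 &
  F (x + t *: unit_row i + t *: unit_row j) - F (x + t *: unit_row i)
    - (F (x + t *: unit_row j) - F x) = t ^+ 2 * partial j (partial i F)
    (x + a *: (t *: unit_row i) + b *: (t *: unit_row j))].
Proof.
move=> oU CF xU.
pose G y := F (y + t *: unit_row j) - F y.
have dG (a : R) : 0 <= a <= 1 ->
    is_derive (x + a *: (t *: unit_row i)) (t *: unit_row i) G
    (t * partial i F (x + a *: (t *: unit_row i) + t *: unit_row j) -
     t * partial i F (x + a *: (t *: unit_row i))).
  move=> aI; apply: is_deriveB; last first.
    apply: is_derive_dirZ; apply: DeriveDef => //; apply: Ck_derivable CF _.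
    by have := xU a 0 aI; rewrite scale0r addr0; apply; rewrite lexx ler01.
  apply: is_derive_translate; apply: is_derive_dirZ; apply: DeriveDef => //.
  apply: Ck_derivable CF _.
  by have := xU a 1 aI; rewrite scale1r; apply; rewrite lexx ler01.
have [|a /andP[a0 a1] Ea] := @mvt_line _ _ G x (t *: unit_row i).
  by move=> a /dG[].
have {a0 a1}aI : 0 <= a <= 1 by rewrite !ltW.
have dH (b : R) : 0 <= b <= 1 ->
    is_derive (x + a *: (t *: unit_row i) + b *: (t *: unit_row j))
      (t *: unit_row j) (partial i F) (t * partial j (partial i F)
        (x + a *: (t *: unit_row i) + b *: (t *: unit_row j))).
  move=> bI; apply: is_derive_dirZ; apply: DeriveDef => //.
  by apply: Ck_derivable (Ck_partial i CF) _; exact: xU.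
have [|b /andP[b0 b1] Eb] :=
    @mvt_line _ _ (partial i F) (x + a *: (t *: unit_row i)) (t *: unit_row j).
  by move=> b /dH[].
have {b0 b1}bI : 0 <= b <= 1 by rewrite !ltW.
exists a, b; split=> //; rewrite -/(G (x + t *: unit_row i)) -/(G x) Ea.
have [_ ->] := dG a aI; rewrite -mulrBr Eb.
by have [_ ->] := dH b bI; rewrite expr2 mulrA.
Qed.

(* Both mixed derivatives are limits of the same second difference quotient. *)
Lemma schwarz U F x i j : open U -> Ck 2 U F -> U x ->
  partial i (partial j F) x = partial j (partial i F) x.
Proof.
move=> oU CF Ux; apply/eqP; rewrite -subr_eq0 -normr_le0.
apply/ler_addgt0Pr => e e0; rewrite add0r.
have : \forall y \near x, [/\ U y,
    `|partial i (partial j F) y - partial i (partial j F) x| < e / 2 &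
    `|partial j (partial i F) y - partial j (partial i F) x| < e / 2].
  have cij := Ck_continuous (Ck_partial i (Ck_partial j CF)) Ux.
  have cji := Ck_continuous (Ck_partial j (Ck_partial i CF)) Ux.
  have e20 : 0 < e / 2 by rewrite divr_gt0.
  have n3 : \forall y \near x, U y by exact: open_near oU Ux _.
  exact: near_and3 n3 (continuous_at_near cij e20) (continuous_at_near cji e20).
move=> /nbhs_ballP[r /= r0 rU].
(* Two moves of length at most t change a coordinate by at most 2 t < r, even when i = j. *)
pose t := r / 3.
have xb k l (a b : R) : 0 <= a <= 1 -> 0 <= b <= 1 ->
    ball x r (x + a *: (t *: unit_row k) + b *: (t *: unit_row l)).
  move=> aI bI; apply/ball_rVP => // m; rewrite !mxE eqxx/=.
  have dI (c : bool) : 0 <= (c%:R : R) <= 1 by case: c; rewrite ?lexx ?ler01.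
  move: (dI (m == k)) (dI (m == l)); set p := (_ %:R); set q := (_ %:R).
  move=> pI qI; have -> : x 0 m + a * (t * p) + b * (t * q) - x 0 m =
    a * t * p + b * t * q by ring.
  have t0 : 0 < t by rewrite divr_gt0.
  have H (c d : R) : 0 <= c <= 1 -> 0 <= d <= 1 -> 0 <= c * t * d <= t.
    move=> /andP[c0 c1] /andP[d0 d1]; apply/andP; split.
      by rewrite !mulr_ge0// ltW.
    by rewrite mulrAC -[leRHS]mul1r ler_wpM2r ?(ltW t0)// mulr_ile1.
  have /andP[? ?] := H a p aI pI; have /andP[? ?] := H b q bI qI.
  rewrite ger0_norm ?addr_ge0//; have -> : r = t * 3 by rewrite /t mulfVK.
  lra.
have [|a1 [b1 [a1I b1I E1]]] := @second_difference U F x i j t oU CF.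
  by move=> a b aI bI; have [] := rU _ (xb i j a b aI bI).
have [|a2 [b2 [a2I b2I E2]]] := @second_difference U F x j i t oU CF.
  by move=> a b aI bI; have [] := rU _ (xb j i a b aI bI).
have t2 : t ^+ 2 != 0 by rewrite expf_neq0// gt_eqF// divr_gt0.
have sub4 (A B C D p q : R) : A - B - (C - D) = t ^+ 2 * p ->
    A - C - (B - D) = t ^+ 2 * q -> p = q.
  by move=> Ep Eq; apply: (mulfI t2); rewrite -Ep -Eq; ring.
rewrite (addrAC x (t *: unit_row j)) in E2.
have E := sub4 _ _ _ _ _ _ E1 E2.
have [_ _] := rU _ (xb i j a1 b1 a1I b1I).
have [_ + _] := rU _ (xb j i a2 b2 a2I b2I).
rewrite -E => h1 h2; rewrite distrC in h1.
apply: le_trans (ler_distD _ _ _) _; apply: ltW; rewrite [ltRHS]splitr.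
exact: ltrD h1 h2.
Qed.

Definition hessmx F x : 'M[R]_n := \matrix_(i, j) partial i (partial j F) x.

(** The Lagrange form of the remainder serves twice at a critical point: for a bound uniform on a
    ball, and for the pointwise limit of the rescaled exponent. *)
Lemma taylor2 U F x z : open U -> Ck 2 U F ->
  (forall t : R, 0 <= t <= 1 -> U (x + t *: z)) ->
  exists2 t : R, 0 < t < 1 & F (x + z) = F x + 'D_z F x +
    2^-1 * (z *m hessmx F (x + t *: z) *m z^T) 0 0.
Proof.
move=> oU CF zU.
pose phi (t : R) := F (x + t *: z).
pose phi1 (t : R) := 'D_z F (x + t *: z).
pose phi2 (t : R) : R := (z *m hessmx F (x + t *: z) *m z^T) 0 0.
have d1 (t : R) : 0 <= t <= 1 -> is_derive t 1 phi (phi1 t).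
  move=> tI; apply: (is_derive_line F x z t _).1; apply: DeriveDef => //.
  by apply: diff_derivable; apply: Ck1_diff oU (CkS CF) (zU _ tI).
have d2 (t : R) : 0 <= t <= 1 -> is_derive t 1 phi1 (phi2 t).
  move=> tI; apply: (is_derive_line ('D_z F) x z t _).1.
  apply: (@near_eq_is_derive _ _ _ (fun y => \sum_i z 0 i * partial i F y)).
    apply: (open_near oU (zU _ tI)) => y Uy.
        by rewrite derive_partial//; exact: Ck1_diff oU (CkS CF) Uy.
  have -> : (fun y => \sum_i z 0 i * partial i F y) =
            \sum_i (z 0 i *: (partial i F : _ -> R^o)).
    by apply/funext => y; rewrite fct_sumE.
  rewrite /phi2 mxE; apply: is_derive_eq.
    apply: is_derive_sum => i; apply: is_deriveZ; apply: DeriveDef.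
      by apply: diff_derivable; apply: Ck1_diff oU (Ck_partial i CF) (zU _ tI).
    by apply: derive_partial; apply: Ck1_diff oU (Ck_partial i CF) (zU _ tI).
  apply: eq_bigr => i _; rewrite mxE [LHS]mulrC; congr (_ * _); last by rewrite mxE.
  by apply: eq_bigr => j _; rewrite !mxE.
(* [c] is chosen so that [psi 0 = psi 1]; as [psi1 0 = 0] too, Rolle's theorem
   applies to [psi], then to its derivative [psi1]. *)
pose c := phi 1 - phi 0 - phi1 0.
pose psi (t : R) := phi t - phi1 0 * t - c * t ^+ 2.
pose psi1 (t : R) := phi1 t - phi1 0 - c * (2 * t).
have dpsi (t : R) : 0 <= t <= 1 -> is_derive t 1 psi (psi1 t).
  move=> tI; have ? := d1 t tI.
  by apply: is_derive_eq; rewrite -![_ *: _]/(_ * _) /psi1; ring.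
have dpsi1 (t : R) : 0 <= t <= 1 -> is_derive t 1 psi1 (phi2 t - c * 2).
  move=> tI; have ? := d2 t tI.
  by apply: is_derive_eq; rewrite -![_ *: _]/(_ * _); ring.
have dcont (f df : R -> R) (b : R) : b <= 1 ->
    (forall t : R, 0 <= t <= 1 -> is_derive t 1 f (df t)) ->
    {within `[0, b], continuous f}.
  move=> b1 D; apply: derivable_within_continuous => t; rewrite in_itv /= => tI.
  by have [] // := D t _; lra.
have psi01 : psi 0 = psi 1 by rewrite /psi /c; ring.
have Dpsi (t : R) : t \in `]0, 1[ -> derivable psi t 1.
  by rewrite in_itv /= => tI; have [] // := dpsi t _; lra.
have [t1] := Rolle ltr01 Dpsi (dcont _ _ _ (lexx 1) dpsi) psi01.
rewrite in_itv /= => /andP[t10 t11] [_ E1].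
have psi101 : psi1 0 = psi1 t1.
  have [_] := dpsi t1 ltac:(lra); rewrite E1 => <-.
  by rewrite /psi1; ring.
have Dpsi1 (t : R) : t \in `]0, t1[ -> derivable psi1 t 1.
  by rewrite in_itv /= => tI; have [] // := dpsi1 t _; lra.
have [t2] := Rolle t10 Dpsi1 (dcont _ _ _ (ltW t11) dpsi1) psi101.
rewrite in_itv /= => /andP[t20 t21] [_ E2].
exists t2; first by lra.
have [_] := dpsi1 t2 ltac:(lra); rewrite E2 /phi2 => /esym/eqP.
rewrite subr_eq0 => /eqP ->; rewrite /c /phi /phi1 !scale0r scale1r addr0; by field.
Qed.

End SecondOrder.

(** * Lebesgue measure on R^n *)

Section EuclidMeasurable.
Context {R : realType}.

Lemma euclid_rowS0 m (x : euclid R m.+1) : euclid_row x 0 ord0 = x.1.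
Proof.
have -> : ord0 = lshift m (ord0 : 'I_1) by exact/val_inj.
by rewrite [LHS](row_mxEl (const_mx x.1 : 'rV[R]_1) (euclid_row x.2)) mxE.
Qed.

Lemma euclid_rowSS m (x : euclid R m.+1) i :
  euclid_row x 0 (lift ord0 i) = euclid_row x.2 0 i.
Proof.
have -> : lift ord0 i = rshift 1 i by exact/val_inj.
exact: (row_mxEr (const_mx x.1 : 'rV[R]_1) (euclid_row x.2)).
Qed.

Lemma euclid_row_surj n (x : 'rV[R]_n) : exists y : euclid R n, euclid_row y = x.
Proof.
elim: n x => [|m IH] x; first by exists tt; apply/rowP => -[].
have [y yE] := IH (\row_i x 0 (lift ord0 i)).
exists (x 0 ord0, y); apply/rowP => i.
have [j ->|->] := unliftP ord0 i; last by rewrite euclid_rowS0.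
by rewrite euclid_rowSS /= yE mxE.
Qed.

Lemma measurable_euclid_coord n i :
  measurable_fun setT (fun x : euclid R n => euclid_row x 0 i : measurableTypeR R).
Proof.
elim: n i => [[]//|m IH] i.
have [j ->|->] := unliftP ord0 i.
  have -> : (fun x : euclid R m.+1 => euclid_row x 0 (lift ord0 j)) =
            (fun y : euclid R m => euclid_row y 0 j) \o snd.
    by apply/funext => x; rewrite euclid_rowSS.
  exact: measurableT_comp (IH j) (@measurable_snd _ _ _ _).
have -> : (fun x : euclid R m.+1 => euclid_row x 0 ord0) = fst.
  by apply/funext => x; rewrite euclid_rowS0.
exact: measurable_fst.
Qed.

(** The sigma-algebra of [euclid] is a product, so [U] is reached as the union of those boxes inside
    it that have a rational centre and half-width 1/(k+1); there are countably many. *)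
Lemma measurable_euclid_open n (U : set 'rV[R]_n) : open U ->
  measurable ((@euclid_row R n) @^-1` U).
Proof.
move=> oU.
pose B (p : 'rV[rat]_n * nat) : set (euclid R n) :=
  [set x | forall i, euclid_row x 0 i \in
     `](ratr (p.1 0 i) - p.2.+1%:R^-1), (ratr (p.1 0 i) + p.2.+1%:R^-1)[%R].
pose G := [set p | B p `<=` (@euclid_row R n) @^-1` U].
have -> : (@euclid_row R n) @^-1` U = \bigcup_(p in G) B p.
  apply/seteqP; split=> [x /= Ux|x [p Gp Bx]]; last exact: Gp.
  have /nbhs_ballP[r /= r0 rU] : nbhs (euclid_row x) U by exact: open_nbhs_nbhs.
  (* Then 1/(k+1) < r/2, and a box of this half-width whose centre is that close to the point lies
     in the ball of radius r. *)
  pose k := Num.trunc (r / 2)^-1.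
  have k0 : 0 < k.+1%:R^-1 :> R by [].
  have kr : k.+1%:R^-1 < r / 2.
    rewrite -[ltRHS]invrK ltf_pV2 ?posrE ?invr_gt0 ?divr_gt0//.
    exact: truncnS_gt.
  have /choice[q qE] (i : 'I_n) : exists q : rat,
      ratr q \in `](euclid_row x 0 i), (euclid_row x 0 i + k.+1%:R^-1)[%R.
    by apply: rat_in_itvoo; rewrite ltrDl.
  exists (\row_i q i, k).
    move=> y /= By; apply: rU; apply/ball_rVP => // i.
    have := qE i; have := By i; rewrite /= mxE !in_itv /=.
    move: (k.+1%:R^-1) kr => d dr /andP[? ?] /andP[? ?].
    by rewrite ltr_norml; apply/andP; split; lra.
  move=> i /=; have := qE i; rewrite mxE !in_itv /=.
  move: (k.+1%:R^-1) k0 => d d0 /andP[? ?].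
  by apply/andP; split; lra.
have mB p : measurable (B p).
  have -> : B p = \bigcap_(i in [set: 'I_n]) ((fun x => euclid_row x 0 i) @^-1`
     `](ratr (p.1 0 i) - p.2.+1%:R^-1), (ratr (p.1 0 i) + p.2.+1%:R^-1)[%classic).
    apply/seteqP; split=> x /= H i; first by move=> _; exact: H.
    exact: (H i).
  apply: fin_bigcap_measurable => // i _.
  rewrite -[X in measurable X]setTI; apply: measurable_euclid_coord => //.
rewrite bigcup_mkcond; apply: countable_bigcupT_measurable; first exact: countableP.
by move=> p; case: ifP.
Qed.

Lemma measurable_continuous_euclid n (F : 'rV[R]_n -> R) : continuous F ->
  measurable_fun setT (fun x : euclid R n => F (euclid_row x) : measurableTypeR R).
Proof.
move=> cF; apply: (measurability _ (RGenOpens.measurableE R)).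
move=> _ [_ [a [b ->]] <-]; rewrite setTI.
apply: (@measurable_euclid_open n (F @^-1` `]a, b[%classic)).
by move/continuousP : cF; apply; exact: interval_open.
Qed.

End EuclidMeasurable.

(** * Affine substitutions in integrals *)

Section Affine.
Context {R : realType}.
Local Notation mu := (@lebesgue_measure R).

(** After multiplication by [s], the pushforward agrees with Lebesgue measure on half-open
    intervals, which determine that measure. *)
Lemma lebesgue_affine (a s : R) (A : set R) : 0 < s -> measurable A ->
  pushforward mu ((fun x => a + s * x) : _ -> measurableTypeR R) A =
  (s^-1%:E * mu A)%E.
Proof.
move=> s0 mA.
have mf : measurable_fun setT
    ((fun x => a + s * x) : measurableTypeR R -> measurableTypeR R).
  apply: measurable_funD; first exact: measurable_cst.
  by apply: measurable_funM => //; exact: measurable_cst.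
pose nu := measure_function_pushforward__canonical__measure_function_Measure mu mf.
pose k : {nonneg R} := NngNum (ltW s0).
have : mu A = mscale k nu A.
  apply: lebesgue_measure_unique => // _ [[b c] _ <-] /=.
  rewrite /mscale /= /pushforward /=.
  have -> : (fun x => a + s * x) @^-1` `]b, c]%classic =
      `]((b - a) / s), ((c - a) / s)]%classic.
    apply/seteqP; split=> x /=; rewrite !in_itv /= ltr_pdivrMr// ler_pdivlMr//;
      by move=> /andP[? ?]; apply/andP; split; lra.
  rewrite !lebesgue_measure_itv /= !lte_fin ltr_pM2r ?invr_gt0// ltrD2r.
  case: ifP => _; last by rewrite mule0.
  by rewrite -!EFinB -EFinM; congr EFin; field; rewrite gt_eqF.
by rewrite /mscale /= => ->; rewrite muleA -EFinM mulVf ?gt_eqF// mul1e.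
Qed.

Lemma ge0_integral_affine1 (a s : R) (F : R -> \bar R) : 0 < s ->
  measurable_fun (setT : set (measurableTypeR R)) F -> (forall x, 0 <= F x)%E ->
  (\int[mu]_x F (a + s * x)%R = s^-1%:E * \int[mu]_x F x)%E.
Proof.
move=> s0 mF F0.
have mf : measurable_fun setT
    ((fun x => a + s * x) : measurableTypeR R -> measurableTypeR R).
  apply: measurable_funD; first exact: measurable_cst.
  by apply: measurable_funM => //; exact: measurable_cst.
rewrite -[X in (\int[_]_(_ in X) _)%E]/((fun x : measurableTypeR R =>
  a + s * x : measurableTypeR R) @^-1` setT).
rewrite -(ge0_integral_pushforward mf)//.
have s'0 : 0 <= s^-1 by rewrite invr_ge0 ltW.
rewrite -(@ge0_integral_mscale _ _ _ mu setT measurableT (NngNum s'0))//.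
by apply: eq_measure_integral => A mA _; exact: lebesgue_affine.
Qed.

(** The map x |-> a + s x written on nested pairs rather than on row vectors, so that its effect on
    integrals follows from Tonelli one factor at a time. *)
Fixpoint euclid_affine n : euclid R n -> R -> euclid R n -> euclid R n :=
  match n return euclid R n -> R -> euclid R n -> euclid R n with
  | 0 => fun _ _ _ => tt
  | m.+1 => fun a s x => (a.1 + s * x.1, euclid_affine a.2 s x.2)
  end.

Lemma euclid_row_affine n (a : euclid R n) s x :
  euclid_row (euclid_affine a s x) = euclid_row a + s *: euclid_row x.
Proof.
elim: n a x => [|m IH] a x; first by apply/rowP => -[].
apply/rowP => i; rewrite [RHS]mxE [X in _ + X]mxE.
have [j ->|->] := unliftP ord0 i; last by rewrite !euclid_rowS0.
by rewrite !euclid_rowSS IH !mxE.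
Qed.

Lemma measurable_euclid_affine n (a : euclid R n) s :
  measurable_fun setT (euclid_affine a s).
Proof.
elim: n a => [|m IH] a; first exact: measurable_cst.
apply: measurable_fun_pair => /=.
  apply: measurable_funD; first exact: measurable_cst.
  by apply: measurable_funM => //; exact: measurable_fst.
exact: measurableT_comp (IH a.2) (@measurable_snd _ _ _ _).
Qed.

Lemma ge0_integral_affine n (a : euclid R n) (s : R) (F : euclid R n -> \bar R) :
  0 < s -> measurable_fun setT F -> (forall x, 0 <= F x)%E ->
  (\int[lebesgue_euclid R n]_x F (euclid_affine a s x) =
   (s ^- n)%:E * \int[lebesgue_euclid R n]_x F x)%E.
Proof.
move=> s0; elim: n a F => [|m IH] a F mF F0.
  by rewrite expr0 invr1 mul1e; apply: eq_integral => -[] _; congr F.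
have mA := measurable_euclid_affine a s.
have mFA : measurable_fun setT (F \o euclid_affine a s).
  exact: measurableT_comp mF mA.
pose G (x : measurableTypeR R) := (\int[lebesgue_euclid R m]_y F (x, y))%E.
have mG : measurable_fun setT G.
  exact: (@measurable_fun_fubini_tonelli_F _ _ _ _ _ (lebesgue_euclid R m) F).
have G0 x : (0 <= G x)%E by apply: integral_ge0.
have -> : (\int[lebesgue_euclid R m.+1]_x F x = \int[mu]_x G x)%E.
  exact: (@fubini_tonelli1 _ _ _ _ _ mu (lebesgue_euclid R m) F).
have -> : (\int[lebesgue_euclid R m.+1]_x F (euclid_affine a s x) =
    \int[mu]_x \int[lebesgue_euclid R m]_y F ((a.1 + s * x)%R, euclid_affine a.2 s y))%E.
  exact: (@fubini_tonelli1 _ _ _ _ _ mu (lebesgue_euclid R m) _ mFA (fun x => F0 _)).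
have sm0 : 0 <= s ^- m by rewrite invr_ge0 exprn_ge0// ltW.
transitivity (\int[mu]_x ((s ^- m)%:E * G (a.1 + s * x)%R))%E.
  apply: eq_integral => x _.
  rewrite (IH a.2 (fun y => F (a.1 + s * x, y)))//.
  exact: measurableT_comp mF (measurable_pair1 _).
rewrite ge0_integralZl//; last first.
  apply: (measurableT_comp mG).
  apply: measurable_funD; first exact: measurable_cst.
  by apply: measurable_funM => //; exact: measurable_cst.
by rewrite ge0_integral_affine1// muleA -EFinM exprS invfM mulrC.
Qed.

End Affine.

(** * Gaussian integrals *)

Section QuadraticForm.
Context {R : realType}.

Definition qform n (A : 'M[R]_n) (z : 'rV[R]_n) : R := (z *m A *m z^T) 0 0.

Definition posdef n (A : 'M[R]_n) : Prop :=
  A^T = A /\ forall z, z != 0 -> 0 < qform A z.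

Let add00 (X Y : 'M[R]_1) : (X + Y) 0 0 = X 0 0 + Y 0 0. Proof. by rewrite mxE. Qed.
Let scale00 (c : R) (X : 'M[R]_1) : (c *: X) 0 0 = c * X 0 0.
Proof. by rewrite mxE. Qed.

Lemma qformE n (A : 'M[R]_n) z :
  qform A z = \sum_j (\sum_i z 0 i * A i j) * z 0 j.
Proof. by rewrite /qform mxE; apply: eq_bigr => j _; rewrite !mxE. Qed.

Lemma qformZ n (A : 'M[R]_n) t z : qform A (t *: z) = t ^+ 2 * qform A z.
Proof.
by rewrite /qform linearZ /= -scalemxAr -!scalemxAl scalerA mxE expr2.
Qed.

Lemma qformD n (A B : 'M[R]_n) z : qform (A + B) z = qform A z + qform B z.
Proof. by rewrite /qform mulmxDr mulmxDl mxE. Qed.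

Lemma qformN n (A : 'M[R]_n) z : qform (- A) z = - qform A z.
Proof. by rewrite /qform mulmxN mulNmx mxE. Qed.

Lemma continuous_qform n (A : 'M[R]_n) : continuous (qform A).
Proof.
have -> : qform A = fun z => \sum_j (\sum_i z 0 i * A i j) * z 0 j.
  by apply/funext => z; exact: qformE.
move=> z; apply: continuous_at_sum => j _; apply: continuous_atM.
  apply: continuous_at_sum => i _; apply: continuous_atM.
    exact: coord_continuous.
  exact: continuous_at_cst.
exact: coord_continuous.
Qed.

Definition schur m (A : 'M[R]_(1 + m)) : 'M[R]_m :=
  drsubmx A - (A 0 0)^-1 *: ((ursubmx A)^T *m ursubmx A).

Section Schur.
Variables (m : nat) (A : 'M[R]_(1 + m)).
Hypotheses (symA : A^T = A) (A00 : A 0 0 != 0).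
Let a := A 0 0.
Let b := ursubmx A.

Let AE : A = block_mx a%:M b b^T (drsubmx A).
Proof.
rewrite -[LHS]submxK; congr block_mx.
  rewrite [LHS]mx11_scalar; congr (_%:M); rewrite !mxE /a.
  by congr (A _ _); exact/val_inj.
by rewrite -{1}symA -trmx_ursub.
Qed.

(* Completing the square in the first coordinate *)
Lemma qform_schur t (w : 'rV[R]_m) :
  qform A (row_mx t%:M w) =
  a * (t + a^-1 * (b *m w^T) 0 0) ^+ 2 + qform (schur A) w.
Proof.
have wb : (w *m b^T) 0 0 = (b *m w^T) 0 0.
  by rewrite -[w in LHS]trmxK -trmx_mul mxE.
have -> : qform A (row_mx t%:M w) =
    t ^+ 2 * a + 2 * t * (b *m w^T) 0 0 + qform (drsubmx A) w.
  rewrite /qform [in LHS]AE tr_row_mx mul_row_block mul_row_col tr_scalar_mx.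
  rewrite mul_mx_scalar !mulmxDl !mul_scalar_mx -!scalemxAl !(add00, scale00) wb.
  by rewrite [a%:M 0 0]mxE mulr1n; ring.
have -> : qform (schur A) w = qform (drsubmx A) w - a^-1 * (b *m w^T) 0 0 ^+ 2.
  rewrite /qform /schur -/a -/b mulmxBr mulmxBl -scalemxAr -scalemxAl.
  rewrite -scaleN1r !(add00, scale00) mulmxA -(mulmxA (w *m b^T)).
  rewrite [((w *m b^T) *m _) 0 0]mxE.
  by rewrite big_ord1 wb -expr2 mulN1r.
by field.
Qed.

(** Right multiplication by the unipotent matrix [U] clears the rest of the first row and leaves the
    Schur complement in the lower corner. *)
Lemma det_schur : \det A = a * \det (schur A).
Proof.
pose U : 'M[R]_(1 + m) := block_mx 1%:M (- a^-1 *: b) 0 1%:M.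
have detU : \det U = 1 by rewrite det_ublock !det1 mulr1.
have E : A *m U = block_mx a%:M 0 b^T (schur A).
  rewrite {1}AE mulmx_block !mulmx1 !mulmx0 !addr0; congr block_mx.
    rewrite mul_scalar_mx scalerA mulrN divff// scaleN1r.
    by rewrite addrC subrr.
  by rewrite -scalemxAr scaleNr addrC.
by rewrite -[LHS]mulr1 -detU -det_mulmx E det_lblock det_scalar1.
Qed.

End Schur.

Lemma posdef_schur m (A : 'M[R]_(1 + m)) : posdef A ->
  0 < A 0 0 /\ posdef (schur A).
Proof.
move=> [symA pA].
have A00 : 0 < A 0 0.
  have := pA (delta_mx 0 0); rewrite /qform -rowE trmx_delta -colE !mxE; apply.
  by apply/eqP => /rowP/(_ 0)/eqP; rewrite !mxE !eqxx oner_eq0.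
have A00n : A 0 0 != 0 by rewrite gt_eqF.
split=> //; split.
  rewrite /schur linearB linearZ /= trmx_mul trmxK; congr (_ - _).
  by rewrite trmx_drsub symA.
move=> w w0.
(* The first coordinate at which the completed square vanishes, leaving only the form of the Schur
   complement. *)
pose t := - ((A 0 0)^-1 * (ursubmx A *m w^T) 0 0).
have := pA (row_mx t%:M w); rewrite qform_schur// /t addNr expr0n mulr0 add0r.
apply; apply: contra w0 => /eqP E; apply/eqP.
by rewrite -[w](row_mxKr (t%:M : 'M[R]_1)) E linear0.
Qed.

Lemma posdef_det_gt0 n (A : 'M[R]_n) : posdef A -> 0 < \det A.
Proof.
elim: n A => [|m IH] A pA; first by rewrite det_mx00.
have [A00 pS] := posdef_schur pA; have [symA _] := pA.
by rewrite (@det_schur m)// ?gt_eqF// mulr_gt0//; exact: IH.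
Qed.

(** If [qform S z = 0], the polynomial t |-> [qform S (z + t *: w)] has no constant term and is
    nonnegative. Its linear coefficient is therefore 0 for every [w], which says [z *m S = 0]. *)
Lemma semidef_posdef n (S : 'M[R]_n) : S^T = S ->
  (forall z, 0 <= qform S z) -> (forall z : 'rV[R]_n, z *m S = 0 -> z = 0) ->
  posdef S.
Proof.
move=> symS S0 kerS; split=> // z z0; rewrite lt_neqAle S0 andbT eq_sym.
apply: contra z0 => /eqP qz; apply/eqP/kerS.
suff H (w : 'rV[R]_n) : (z *m S *m w^T) 0 0 = 0.
  by apply/rowP => i; have := H (unit_row i); rewrite trmx_delta -colE !mxE.
set beta := (z *m S *m w^T) 0 0; set gamma := qform S w.
have g0 : 0 <= gamma by exact: S0.
have wz : (w *m S *m z^T) 0 0 = beta.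
  by rewrite /beta -[in LHS]symS -[w in LHS]trmxK -!trmx_mul mulmxA mxE.
have E (t : R) : qform S (z + t *: w) = 2 * t * beta + t ^+ 2 * gamma.
  have mE (X Y : 'M[R]_1) : (X + Y) 0 0 = X 0 0 + Y 0 0 by rewrite mxE.
  have sE (s : R) (X : 'M[R]_1) : (s *: X) 0 0 = s * X 0 0 by rewrite mxE.
  rewrite /qform linearD linearZ /= !mulmxDl !mulmxDr -!scalemxAr -!scalemxAl.
  rewrite !(mE, sE) -/(qform S z) -/(qform S w) qz wz -/beta -/gamma; ring.
(* A step in the direction that lowers the form; the added 1 keeps the denominator positive when
   [gamma] is 0. *)
have := S0 (z - (beta / (gamma + 1)) *: w).
rewrite -scaleNr E.
have g1 : gamma + 1 != 0 by rewrite gt_eqF// ltr_wpDl.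
have -> : 2 * - (beta / (gamma + 1)) * beta + (- (beta / (gamma + 1))) ^+ 2 * gamma =
    - (beta ^+ 2 * ((gamma + 2) / (gamma + 1) ^+ 2)) by field.
rewrite oppr_ge0 pmulr_lle0; last by rewrite divr_gt0 ?exprn_gt0 ?ltr_wpDl.
by move=> b0; apply/eqP; rewrite -sqrf_eq0 eq_le b0 sqr_ge0.
Qed.

End QuadraticForm.

Section Gaussian.
Context {R : realType}.
Local Notation mu := (@lebesgue_measure R).

(** The integrand is the normal density of mean -c and variance 1/a, divided by its peak value. *)
Lemma integral_gauss1 (a c : R) : 0 < a ->
  (\int[mu]_x (expR (- 2^-1 * (a * (x + c) ^+ 2)))%:E = (Num.sqrt (2 * pi / a))%:E)%E.
Proof.
move=> a0; pose s := Num.sqrt a^-1.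
have s2 : s ^+ 2 = a^-1 by rewrite sqr_sqrtr// invr_ge0 ltW.
have s0 : s != 0 by rewrite sqrtr_eq0 -ltNge invr_gt0.
have p0 := normal_peak_gt0 s0.
have pE : (normal_peak s)^-1 = Num.sqrt (2 * pi / a).
  by rewrite /normal_peak invrK s2; congr Num.sqrt; ring.
transitivity (\int[mu]_x ((normal_peak s)^-1%:E * (normal_pdf (- c) s x)%:E))%E.
  apply: eq_integral => x _; rewrite normal_pdfE// -EFinM mulKf ?gt_eqF//.
  congr (expR _)%:E; rewrite opprK s2; field; rewrite gt_eqF//.
rewrite ge0_integralZl//=.
- by rewrite integral_normal_pdf mule1 pE.
- by apply/measurable_EFinP; exact: measurable_normal_pdf.
- by move=> x _; rewrite lee_fin normal_pdf_ge0.
- by rewrite lee_fin invr_ge0 ltW.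
Qed.

Lemma continuous_gaussian n (A : 'M[R]_n) (c : R) :
  continuous (fun z => expR (c * qform A z)).
Proof.
move=> z; apply: (@continuous_comp _ _ _ (fun z => c * qform A z) expR).
  by apply: continuous_atM; [exact: continuous_at_cst|exact: continuous_qform].
exact: continuous_expR.
Qed.

Lemma measurable_gaussian n (A : 'M[R]_n) (c : R) :
  measurable_fun setT (fun x : euclid R n => (expR (c * qform A (euclid_row x)))%:E).
Proof.
apply/measurable_EFinP.
apply: (@measurable_continuous_euclid R n (fun z => expR (c * qform A z))).
exact: continuous_gaussian.
Qed.

(** Completing the square in the first coordinate leaves a shift depending on the other coordinates,
    which the one-dimensional integral does not see. Tonelli thus separates the factor sqrt(2 pi /
    a), with a = [A 0 0], from the Gaussian of the Schur complement, whose determinant is det A /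
    a. *)
Lemma integral_gaussian n (A : 'M[R]_n) : posdef A ->
  (\int[lebesgue_euclid R n]_x (expR (- 2^-1 * qform A (euclid_row x)))%:E =
   (Num.sqrt ((2 * pi) ^+ n / \det A))%:E)%E.
Proof.
elim: n A => [|m IH] A pA.
  rewrite integral_dirac//= diracT mul1e /qform det_mx00 divr1 sqrtr1.
  by rewrite mxE big_ord0 mulr0 expR0.
have [A00 pS] := posdef_schur pA; have [symA _] := pA.
have mF := measurable_gaussian A (- 2^-1).
have F0 (x : euclid R m.+1) :
  (0 <= (expR (- 2^-1 * qform A (euclid_row x)))%:E)%E by rewrite lee_fin expR_ge0.
rewrite [LHS](@fubini_tonelli2 _ _ _ _ _ mu (lebesgue_euclid R m) _ mF F0).
pose c : R := Num.sqrt (2 * pi / A 0 0).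
have c0 : 0 <= c by exact: sqrtr_ge0.
transitivity (\int[lebesgue_euclid R m]_y
   (c%:E * (expR (- 2^-1 * qform (@schur R m A) (euclid_row y)))%:E))%E.
  apply: eq_integral => y _.
  rewrite /fubini_G; under eq_integral => x _.
    have -> : euclid_row ((x, y) : euclid R m.+1) = row_mx x%:M (euclid_row y).
      rewrite -[LHS]/(row_mx (const_mx x : 'rV[R]_1) (euclid_row y)).
      suff -> : const_mx x = x%:M :> 'rV[R]_1 by [].
      by apply/matrixP => i j; rewrite !mxE !ord1 mulr1n.
    rewrite (@qform_schur R m)// ?gt_eqF// mulrDr expRD mulrC EFinM.
    over.
  rewrite ge0_integralZl//=.
  - by rewrite integral_gauss1// muleC.
  - apply/measurable_EFinP; apply: measurableT_comp => //.
    do 2 (apply: measurable_funM; first exact: measurable_cst).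
    by apply: measurable_funX; apply: measurable_funD => //; exact: measurable_cst.
rewrite ge0_integralZl//=.
- rewrite IH// -EFinM -sqrtrM; last by rewrite divr_ge0 ?mulr_ge0 ?pi_ge0 ?(ltW A00).
  congr (Num.sqrt _)%:E; rewrite (@det_schur R m)// ?gt_eqF// exprS.
  field; rewrite !gt_eqF//; exact: posdef_det_gt0.
- exact: measurable_gaussian.
Qed.

End Gaussian.

(** * Laplace's method in R^n *)

Section Laplace.
Context {R : realType} {n : nat}.

(** The squared Euclidean norm: the library norm on row vectors is the maximum norm, whereas the
    dominating function has to be the exponential of a quadratic form. *)
Definition sqnorm (z : 'rV[R]_n) : R := (z *m z^T) 0 0.

Lemma sqnormE z : sqnorm z = \sum_i z 0 i ^+ 2.
Proof. by rewrite /sqnorm mxE; apply: eq_bigr => i _; rewrite mxE expr2. Qed.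

Lemma sqnorm_ge0 z : 0 <= sqnorm z.
Proof. by rewrite sqnormE; apply: sumr_ge0 => i _; exact: sqr_ge0. Qed.

Lemma sqnorm_gt0 z : z != 0 -> 0 < sqnorm z.
Proof.
move=> z0; rewrite lt_neqAle sqnorm_ge0 andbT eq_sym sqnormE psumr_eq0; last first.
  by move=> i _; exact: sqr_ge0.
apply: contra z0 => /allP z0; apply/eqP/rowP => i; rewrite mxE.
by have := z0 i; rewrite mem_index_enum sqrf_eq0 /= => /(_ isT)/eqP.
Qed.

Lemma qform_scalar (c : R) z : qform c%:M z = c * sqnorm z.
Proof. by rewrite /qform mul_mx_scalar -scalemxAl mxE. Qed.

Lemma sqnormZ (c : R) z : sqnorm (c *: z) = c ^+ 2 * sqnorm z.
Proof. by rewrite -[LHS]mul1r -qform_scalar qformZ qform_scalar mul1r. Qed.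

Lemma posdef_scalar (c : R) : 0 < c -> posdef (c%:M : 'M[R]_n).
Proof.
move=> c0; split; first by rewrite tr_scalar_mx.
by move=> z z0; rewrite qform_scalar mulr_gt0// sqnorm_gt0.
Qed.

Lemma integrable_gaussian (C e : R) : 0 < e ->
  (lebesgue_euclid R n).-integrable setT
    (fun y => (C * expR (- (e * sqnorm (euclid_row y))))%:E).
Proof.
move=> e0.
have E y : expR (- (e * sqnorm (euclid_row y))) =
           expR (- 2^-1 * qform (2 * e)%:M (euclid_row y) : R).
  by congr expR; rewrite qform_scalar; field.
rewrite (_ : (fun y => _) = (fun y => C%:E *
    (expR (- 2^-1 * qform (2 * e)%:M (euclid_row y)))%:E)%E); last first.
  by apply/funext => y; rewrite E EFinM.
apply: integrableZl => //; apply/integrableP; split.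
  exact: measurable_gaussian.
under eq_integral => y _ do rewrite gee0_abs ?lee_fin ?expR_ge0//.
by rewrite integral_gaussian ?ltry//; apply: posdef_scalar; rewrite mulr_gt0.
Qed.

(** For infinite [x] the product is still infinite and [fine] sends both to 0. Constants can thus be
    moved out of an integral before anything is known about its finiteness. *)
Lemma fine_mulEFin (c : R) (x : \bar R) : 0 < c -> fine (c%:E * x) = c * fine x.
Proof.
move=> c0; case: x => [x| |]; first by [].
  by rewrite mulry gtr0_sg// mul1e mulr0.
by rewrite mulrNy gtr0_sg// mul1e mulr0.
Qed.

(* After the substitution [x = x0 + y / sqrt N], the quadratic bound on [psi]
   makes [C * expR (- e |y|^2)] a dominating function for all [N] at once. *)
Lemma laplace_dct (phi psi : 'rV[R]_n -> R) (x0 : 'rV[R]_n) (v C e : R)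
    (L : 'rV[R]_n -> R) : 0 < e -> (forall x, 0 <= phi x <= C) ->
  (forall N, measurable_fun setT
     (fun y : euclid R n => phi (euclid_row y) * expR (N * psi (euclid_row y)))) ->
  measurable_fun setT (fun y : euclid R n => L (euclid_row y)) ->
  (forall z, phi (x0 + z) != 0 -> psi (x0 + z) <= v - e * sqnorm z) ->
  (forall y, phi (x0 + (Num.sqrt N)^-1 *: y) *
     expR (N * (psi (x0 + (Num.sqrt N)^-1 *: y) - v)) @[N --> +oo] --> L y) ->
  Num.sqrt N ^+ n * expR (- (N * v)) *
    integral_rV (fun x => phi x * expR (N * psi x)) @[N --> +oo] -->
  fine (\int[lebesgue_euclid R n]_y (L (euclid_row y))%:E)%E.
Proof.
move=> e0 phiC mF mL le_psi lim.
(* Dominated convergence is about sequences, so the limit at infinity is tested along an arbitrary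
   sequence [u] tending to it. *)
apply/cvg_pinftyP => u uoo.
have u_gt0 : \forall k \near \oo, 0 < u k by move/cvgryPgt : uoo; apply.
have [a aE] := euclid_row_surj x0.
pose s k := (Num.sqrt (u k))^-1.
pose h k y := phi (x0 + s k *: y) * expR (u k * (psi (x0 + s k *: y) - v)).
(* The value 0 for [u k <= 0] makes the domination hold for every k and not only for large k. *)
pose f_ k (y : euclid R n) := (if 0 < u k then h k (euclid_row y) else 0)%:E.
have hE k y : h k (euclid_row y) = expR (- (u k * v)) *
    (phi (euclid_row (euclid_affine a (s k) y)) *
     expR (u k * psi (euclid_row (euclid_affine a (s k) y)))).
  rewrite euclid_row_affine aE /h mulrBr expRD; ring.
have mf_ k : measurable_fun setT (f_ k).
  rewrite /f_; case: ltP => _; last exact: measurable_cst.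
  apply/measurable_EFinP => /=.
  have -> : (fun y : euclid R n => h k (euclid_row y)) =
      (fun y => expR (- (u k * v)) *
        (phi (euclid_row (euclid_affine a (s k) y)) *
         expR (u k * psi (euclid_row (euclid_affine a (s k) y))))).
    by apply/funext => y; exact: hE.
  apply: measurable_funM; first exact: measurable_cst.
  exact: measurableT_comp (mF (u k)) (measurable_euclid_affine a (s k)).
have fL : {ae lebesgue_euclid R n, forall y, setT y ->
    f_ ^~ y @ \oo --> (L (euclid_row y))%:E}.
  apply: aeW => y _; apply: cvg_EFin; first by near=> k.
  have /cvg_pinftyP/(_ u uoo) := lim (euclid_row y).
  apply: cvg_trans; apply: near_eq_cvg; near=> k.
  by rewrite /f_ /= ifT//; near: k.
pose g (y : euclid R n) := (C * expR (- (e * sqnorm (euclid_row y))))%:E.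
have ig : (lebesgue_euclid R n).-integrable setT g by exact: integrable_gaussian.
have fg : {ae lebesgue_euclid R n, forall y k, setT y -> (`|f_ k y| <= g y)%E}.
  apply: aeW => y k _; rewrite /f_ /g.
  have [phi0 phileC] := andP (phiC (x0 + s k *: euclid_row y)).
  have C0 : 0 <= C by exact: le_trans phileC.
  rewrite lee_fin; case: ltP => u0; last by rewrite normr0 mulr_ge0// expR_ge0.
  rewrite ger0_norm /h ?mulr_ge0 ?expR_ge0//.
  have [->|pn0] := eqVneq (phi (x0 + s k *: euclid_row y)) 0.
    by rewrite mul0r mulr_ge0// expR_ge0.
  rewrite ler_pM ?expR_ge0// ler_expR.
  have := le_psi _ pn0; rewrite sqnormZ /s exprVn sqr_sqrtr ?(ltW u0)// => le.
  have -> : - (e * sqnorm (euclid_row y)) =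
            u k * - (e * ((u k)^-1 * sqnorm (euclid_row y))).
    by field; rewrite gt_eqF.
  by rewrite ler_pM2l//; lra.
have mLE : measurable_fun setT (fun y : euclid R n => (L (euclid_row y))%:E).
  exact/measurable_EFinP.
have [iL _ cv] := dominated_convergence measurableT mf_ mLE fL ig fg.
have Lfin := integrable_fin_num measurableT iL.
rewrite -(fineK Lfin) in cv; move/fine_cvg : cv.
apply: cvg_trans; apply: near_eq_cvg; near=> k.
have uk : 0 < u k by near: k.
have sk : 0 < s k by rewrite invr_gt0 sqrtr_gt0.
rewrite /f_ /= uk.
under eq_integral => y _ do rewrite hE.
pose H (y : euclid R n) := (expR (- (u k * v)) *
     (phi (euclid_row y) * expR (u k * psi (euclid_row y))))%:E.
have mG : measurable_fun setT (fun y : euclid R n =>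
    (phi (euclid_row y) * expR (u k * psi (euclid_row y)))%:E).
  exact/measurable_EFinP.
have G0 (y : euclid R n) :
    (0 <= (phi (euclid_row y) * expR (u k * psi (euclid_row y)))%:E)%E.
  by rewrite lee_fin mulr_ge0 ?expR_ge0//; have /andP[] := phiC (euclid_row y).
have mH : measurable_fun setT H.
  apply/measurable_EFinP; apply: measurable_funM; first exact: measurable_cst.
  exact/measurable_EFinP.
have H0 y : (0 <= H y)%E by rewrite /H EFinM mule_ge0// lee_fin expR_ge0.
rewrite (@ge0_integral_affine R n a (s k) H)// fine_mulEFin; last first.
  by rewrite invr_gt0 exprn_gt0.
rewrite /H; under eq_integral => y _ do rewrite EFinM.
rewrite ge0_integralZl//= ?lee_fin ?expR_ge0//.
by rewrite fine_mulEFin ?expR_gt0// mulrA exprVn invrK.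
Unshelve. all: by end_near. Qed.

End Laplace.

(** * Quadratic bounds at a maximum and the resulting limit *)

Section LaplacePoint.
Context {R : realType} {n : nat}.
Implicit Types (x y z : 'rV[R]_n) (A : 'M[R]_n).

(** The constant is the minimum of the form on the compact unit sphere of the maximum norm;
    homogeneity of degree 2 extends the bound to all vectors. *)
Lemma posdef_coercive A : posdef A ->
  exists2 m : R, 0 < m & forall z, m * `|z| ^+ 2 <= qform A z.
Proof.
move=> [_ pA].
have unitE z : z != 0 -> `| `|z|^-1 *: z | = 1.
  by move=> z0; rewrite normrZ normfV normr_id mulVf// normr_eq0.
pose S : set 'rV[R]_n := [set z | `|z| = 1].
(* The sphere is empty in dimension 0, where any positive constant will do. *)
have [S0|/set0P S0] := eqVneq S set0.
  exists 1 => // z; have [->|z0] := eqVneq z 0.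
    by rewrite normr0 expr0n mulr0 /qform mul0mx mul0mx mxE.
  have : S (`|z|^-1 *: z) by exact: unitE.
  by rewrite S0.
have cS : compact S.
  apply: bounded_closed_compact.
    by exists 1; split=> // M M1 z /= ->; exact: ltW.
  have -> : S = (fun z => `|z|) @^-1` [set 1] by [].
  apply: closed_comp; last exact: closed_eq.
  by move=> z _; exact: norm_continuous.
have [c cS1 cmin] := EVT_min_rV S0 cS (continuous_subspaceT (@continuous_qform R n A)).
have c1 : `|c| = 1 by move: cS1; rewrite inE.
exists (qform A c).
  by apply: pA; rewrite -normr_gt0 c1.
move=> z; have [->|z0] := eqVneq z 0.
  by rewrite normr0 expr0n mulr0 /qform mul0mx mul0mx mxE.
have := cmin (`|z|^-1 *: z); rewrite inE => /(_ (unitE _ z0)).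
by rewrite qformZ exprVn ler_pdivlMl ?exprn_gt0 ?normr_gt0// mulrC.
Qed.

Lemma sqnorm_le z : sqnorm z <= n%:R * `|z| ^+ 2.
Proof.
rewrite sqnormE mulr_natl -[X in _ *+ X]card_ord -sumr_const.
apply: ler_sum => i _; rewrite -[_ ^+ 2]real_normK ?num_real//.
by rewrite lerXn2r// ?nnegrE// ler_coord_norm.
Qed.

Lemma qform_le A (d : R) z : (forall i j, `|A i j| <= d) ->
  `|qform A z| <= n%:R ^+ 2 * d * `|z| ^+ 2.
Proof.
move=> Ad; rewrite qformE.
have H i j : `|z 0 i * A i j * z 0 j| <= d * `|z| ^+ 2.
  rewrite !normrM mulrAC mulrC expr2.
  by apply: ler_pM; rewrite ?mulr_ge0//; apply: ler_pM => //; exact: ler_coord_norm.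
apply: le_trans (ler_norm_sum _ _ _) _.
have -> : n%:R ^+ 2 * d * `|z| ^+ 2 = \sum_(j < n) n%:R * (d * `|z| ^+ 2).
  by rewrite sumr_const card_ord -mulr_natl; ring.
apply: ler_sum => j _; rewrite mulr_suml.
apply: le_trans (ler_norm_sum _ _ _) _.
rewrite mulr_natl -[X in _ *+ X]card_ord -sumr_const.
by apply: ler_sum => i _; exact: H.
Qed.

(** On a compact set it turns a uniform gap d into the quadratic gap (d / B) |z|^2, the shape that
    [laplace_dct] asks for. *)
Lemma compact_sqnorm_bound (K : set 'rV[R]_n) x0 : compact K ->
  exists2 B : R, 0 < B & forall z, K (x0 + z) -> sqnorm z <= B.
Proof.
move=> /compact_bounded[M [_ HM]].
pose M' := `|M| + 1.
have M'M : M < M' by rewrite /M' (le_lt_trans (ler_norm _))// ltrDl.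
have M'0 : 0 < M' by rewrite ltr_wpDl.
(* The final 1 keeps the bound positive in dimension 0. *)
exists (n%:R * (M' + `|x0|) ^+ 2 + 1).
  by rewrite ltr_wpDl// mulr_ge0// sqr_ge0.
move=> z /(HM _ M'M) /= zM.
apply: le_trans (sqnorm_le z) _; rewrite -[leLHS]addr0 lerD// ler_wpM2l//.
rewrite lerXn2r ?nnegrE ?addr_ge0 ?(ltW M'0)//.
have -> : z = (x0 + z) - x0 by rewrite addrC addKr.
by apply: le_trans (ler_normB _ _) _; rewrite lerD2r.
Qed.

Lemma compact_lt_gap (K : set 'rV[R]_n) (psi : 'rV[R]_n -> R) (v : R) : compact K ->
  (forall x, K x -> {for x, continuous psi}) -> (forall x, K x -> psi x < v) ->
  exists2 d : R, 0 < d & forall x, K x -> psi x <= v - d.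
Proof.
move=> cK Kpsi Kv; have [->|/set0P K0] := eqVneq K set0; first by exists 1.
have [c Kc cmax] : exists2 c, c \in K & forall t, t \in K -> psi t <= psi c.
  apply: EVT_max_rV => //; apply: continuous_in_subspaceT => x.
  by rewrite inE => Kx; exact: Kpsi.
move: Kc; rewrite inE => Kc.
exists (v - psi c); first by rewrite subr_gt0 Kv.
by move=> x Kx; rewrite opprB addrC subrK; apply: cmax; rewrite inE.
Qed.

Variables (psi : 'rV[R]_n -> R) (x0 : 'rV[R]_n) (U : set 'rV[R]_n).
Hypotheses (oU : open U) (Ux0 : U x0) (Cpsi : Ck 2 U psi).
Hypothesis crit : forall i, partial i psi x0 = 0.
Hypothesis hess_posdef : posdef (- hessmx psi x0).

Let taylor_crit z : (forall t : R, 0 <= t <= 1 -> U (x0 + t *: z)) ->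
  exists2 t : R, 0 < t < 1 &
    psi (x0 + z) = psi x0 + 2^-1 * qform (hessmx psi (x0 + t *: z)) z.
Proof.
move=> zU; have [t tI ->] := taylor2 oU Cpsi zU; exists t => //.
congr (_ + _); rewrite -[RHS]addr0; congr (_ + _).
rewrite derive_partial; last exact: Ck1_diff oU (CkS Cpsi) Ux0.
by rewrite big1// => i _; rewrite crit mulr0.
Qed.

Lemma continuous_hess i j : {for x0, continuous (fun x => hessmx psi x i j)}.
Proof.
rewrite (_ : (fun x => _) = partial i (partial j psi)); last first.
  by apply/funext => x; rewrite mxE.
exact: Ck_continuous (Ck_partial i (Ck_partial j Cpsi)) Ux0.
Qed.

Let ballZ r z t : ball x0 r (x0 + z) -> 0 <= t <= 1 -> ball x0 r (x0 + t *: z).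
Proof.
move=> zr /andP[t0 t1].
have r0 : 0 < r by case: zr.
apply/ball_rVP => // i; rewrite !mxE [x0 0 i + _]addrC addrK normrM ger0_norm//.
move/ball_rVP : zr => /(_ r0 i); rewrite !mxE [x0 0 i + _]addrC addrK; apply: le_lt_trans.
by rewrite ler_piMl.
Qed.

Lemma local_quadratic_bound : exists r e : R, [/\ 0 < r, 0 < e &
  forall z, ball x0 r (x0 + z) -> psi (x0 + z) <= psi x0 - e * sqnorm z].
Proof.
have [m m0 mle] := posdef_coercive hess_posdef.
(* Chosen so that n^2 d <= m / 2: by [qform_le], the variation of the Hessian over the ball then
   uses up at most half of the coercivity constant. *)
pose d := m / (2 * (n%:R ^+ 2 + 1)).
have n20 : 0 < n%:R ^+ 2 + 1 :> R by rewrite ltr_wpDl// sqr_ge0.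
have d0 : 0 < d by rewrite divr_gt0// mulr_gt0.
have : \forall y \near x0, U y /\
    forall i j, `|hessmx psi y i j - hessmx psi x0 i j| < d.
  have nU : \forall y \near x0, U y by exact: open_nbhs_nbhs.
  have nH : \forall y \near x0, forall i j,
      `|hessmx psi y i j - hessmx psi x0 i j| < d.
    apply: near_forall => i; apply: near_forall => j.
    exact: continuous_at_near (@continuous_hess i j) d0.
  exact: filterI nU nH.
move=> /nbhs_ballP[r /= r0 rB].
(* The other half, times the Taylor coefficient 1/2, leaves m / 4 times the squared maximum norm;
   the factor n + 1 pays for passing to [sqnorm]. *)
exists r, (m / (4 * (n%:R + 1))); split => //.
  by rewrite divr_gt0// mulr_gt0// ltr_wpDl.
move=> z zr.
have [|t tI ->] := @taylor_crit z.
  by move=> t tI; have [] := rB _ (ballZ zr tI).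
have tI' : 0 <= t <= 1 by case/andP: tI => *; rewrite !ltW.
have [_ Hd] := rB _ (ballZ zr tI').
set H := hessmx psi (x0 + t *: z) in Hd *; set H0 := hessmx psi x0 in Hd mle *.
have E : qform H z = qform (H - H0) z - qform (- H0) z.
  by rewrite qformN opprK -qformD subrK.
have q1 : `|qform (H - H0) z| <= n%:R ^+ 2 * d * `|z| ^+ 2.
  by apply: qform_le => i j; rewrite mxE [X in _ + X]mxE ltW// Hd.
have {}q1 := le_trans (ler_norm _) q1.
have q2 := mle z; have q3 := sqnorm_le z.
have k1 : n%:R ^+ 2 * d <= m / 2.
  rewrite /d mulrA ler_pdivrMr ?mulr_gt0//.
  have -> : m / 2 * (2 * (n%:R ^+ 2 + 1)) = n%:R ^+ 2 * m + m by field.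
  by rewrite lerDl ltW.
have k2 : m / (4 * (n%:R + 1)) * sqnorm z <= m / 4 * `|z| ^+ 2.
  have n10 : 0 < n%:R + 1 :> R by rewrite ltr_wpDl.
  have -> : m / (4 * (n%:R + 1)) * sqnorm z = m / 4 * (sqnorm z / (n%:R + 1)).
    by field; rewrite gt_eqF.
  rewrite ler_wpM2l ?divr_ge0 ?(ltW m0)// ler_pdivrMr//.
  by apply: le_trans q3 _; rewrite mulrC ler_wpM2l ?sqr_ge0// lerDl.
have k3 : n%:R ^+ 2 * d * `|z| ^+ 2 <= m / 2 * `|z| ^+ 2.
  by rewrite ler_wpM2r ?sqr_ge0.
rewrite E; lra.
Qed.

Lemma global_quadratic_bound (K : set 'rV[R]_n) : compact K ->
  (forall x, K x -> {for x, continuous psi}) ->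
  (forall x, K x -> x <> x0 -> psi x < psi x0) ->
  exists2 e : R, 0 < e &
    forall z, K (x0 + z) -> psi (x0 + z) <= psi x0 - e * sqnorm z.
Proof.
move=> cK Kpsi Kmax.
have [r [e1 [r0 e10 near_bound]]] := local_quadratic_bound.
pose K' := K `&` ~` ball x0 r.
have cK' : compact K'.
  apply: compact_closedI => //.
  by apply: open_closedC; apply: ball_open.
have [B B0 KB] := compact_sqnorm_bound x0 cK.
have [d d0 K'd] : exists2 d : R, 0 < d & forall x, K' x -> psi x <= psi x0 - d.
  apply: compact_lt_gap => // [x [Kx _]|x [Kx ncr]]; first exact: Kpsi.
  by apply: Kmax => // E; apply: ncr; rewrite E; exact: ballxx.
(* [e1] serves inside the ball, and d / B on the rest of [K], where the gap d is at least d / B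
   times [sqnorm]. *)
exists (Num.min e1 (d / B)).
  by rewrite lt_min e10 divr_gt0.
move=> z Kz; have [zr|zr] := pselect (ball x0 r (x0 + z)).
  apply: le_trans (near_bound _ zr) _; rewrite lerD2l lerN2.
  by rewrite ler_wpM2r ?sqnorm_ge0// ge_min lexx.
apply: le_trans (K'd _ _) _ => //; rewrite lerD2l lerN2.
apply: (@le_trans _ _ (d / B * sqnorm z)).
  by rewrite ler_wpM2r ?sqnorm_ge0// ge_min lexx orbT.
by rewrite mulrAC ler_pdivrMr// ler_wpM2l ?(ltW d0)// KB.
Qed.

Lemma near_scaled y (r : R) : 0 < r ->
  \forall N \near +oo, 0 < N /\ `|(Num.sqrt N)^-1 *: y| < r.
Proof.
move=> r0; near=> N.
have N0 : 0 < N by near: N; exact: nbhs_pinfty_gt.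
have sN0 : 0 < Num.sqrt N by rewrite sqrtr_gt0.
split=> //; rewrite normrZ ger0_norm ?invr_ge0 ?(ltW sN0)//.
rewrite mulrC ltr_pdivrMr// mulrC -ltr_pdivrMr//.
have q0 : 0 <= `|y| / r by rewrite divr_ge0// ltW.
rewrite -[ltLHS](ger0_norm q0) -sqrtr_sqr ltr_sqrt//.
by near: N; apply: nbhs_pinfty_gt; exact: num_real.
Unshelve. all: by end_near. Qed.

(** The point of evaluation may be anywhere on the segment from [x0] to x0 + y / sqrt N and vary
    with N. This covers both [phi] (t = 1) and the Hessian at the unspecified Taylor point. *)
Lemma cvg_scaled (T : R -> R) (F : 'rV[R]_n -> R) y :
  {for x0, continuous F} ->
  (\forall N \near +oo, exists2 t : R, 0 <= t <= 1 &
     T N = F (x0 + t *: ((Num.sqrt N)^-1 *: y))) ->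
  T N @[N --> +oo] --> F x0.
Proof.
move=> cF nT; apply/cvgrPdistC_lt => e e0.
have /nbhs_ballP[r /= r0 rB] := continuous_at_near cF e0.
have nr := near_scaled y r0.
near=> N.
have [t tI ->] : exists2 t : R, 0 <= t <= 1 &
     T N = F (x0 + t *: ((Num.sqrt N)^-1 *: y)) by near: N.
have [_ yr] : 0 < N /\ `|(Num.sqrt N)^-1 *: y| < r by near: N.
apply: rB; apply: ballZ => //.
by rewrite -ball_normE /ball_ /= opprD addrA subrr add0r normrN.
Unshelve. all: by end_near. Qed.

(** The first-order term vanishes at the critical point, and the factor N cancels the square of 1 /
    sqrt N in the Taylor remainder. *)
Lemma cvg_second_order y :
  N * (psi (x0 + (Num.sqrt N)^-1 *: y) - psi x0) @[N --> +oo] -->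
    2^-1 * qform (hessmx psi x0) y.
Proof.
apply: (@cvg_scaled _ (fun x => 2^-1 * qform (hessmx psi x) y) y).
  apply: continuous_atM; first exact: continuous_at_cst.
  rewrite (_ : (fun _ => _) =
    fun x => \sum_j (\sum_i y 0 i * hessmx psi x i j) * y 0 j); last first.
    by apply/funext => x; rewrite qformE.
  apply: continuous_at_sum => j _; apply: continuous_atM; last exact: continuous_at_cst.
  apply: continuous_at_sum => i _; apply: continuous_atM; first exact: continuous_at_cst.
  exact: continuous_hess.
have : \forall x \near x0, U x by exact: open_nbhs_nbhs.
move=> /nbhs_ballP[r /= r0 rB].
have nr := near_scaled y r0; near=> N.
have [N0 yr] : 0 < N /\ `|(Num.sqrt N)^-1 *: y| < r by near: N.
have [|t tI ->] := @taylor_crit ((Num.sqrt N)^-1 *: y).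
  move=> t tI; apply: rB; apply: ballZ => //.
  by rewrite -ball_normE /ball_ /= opprD addrA subrr add0r normrN.
exists t; first by case/andP: tI => *; rewrite !ltW.
rewrite [X in N * X](_ : _ = 2^-1 * qform (hessmx psi (x0 + t *: ((Num.sqrt N)^-1 *: y)))
  ((Num.sqrt N)^-1 *: y)); last by rewrite addrC addKr.
rewrite qformZ exprVn sqr_sqrtr ?(ltW N0)//.
by field; rewrite gt_eqF.
Unshelve. all: by end_near. Qed.

Lemma laplace_at_max (phi : 'rV[R]_n -> R) (K : set 'rV[R]_n) (C : R) :
  compact K -> (forall x, K x -> {for x, continuous psi}) ->
  (forall x, K x -> x <> x0 -> psi x < psi x0) ->
  (forall x, 0 <= phi x <= C) -> (forall x, phi x != 0 -> K x) ->
  {for x0, continuous phi} ->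
  (forall N, measurable_fun setT
     (fun y : euclid R n => phi (euclid_row y) * expR (N * psi (euclid_row y)))) ->
  Num.sqrt N ^+ n * expR (- (N * psi x0)) *
    integral_rV (fun x => phi x * expR (N * psi x)) @[N --> +oo] -->
  phi x0 * Num.sqrt ((2 * pi) ^+ n / \det (- hessmx psi x0)).
Proof.
move=> cK Kpsi Kmax phiC phiK cphi mF.
have [e e0 le_psi] := global_quadratic_bound cK Kpsi Kmax.
pose L y := phi x0 * expR (- 2^-1 * qform (- hessmx psi x0) y).
have mL : measurable_fun setT (fun y : euclid R n => L (euclid_row y)).
  apply: measurable_funM; first exact: measurable_cst.
  exact/measurable_EFinP/measurable_gaussian.
have -> : phi x0 * Num.sqrt ((2 * pi) ^+ n / \det (- hessmx psi x0)) =
    fine (\int[lebesgue_euclid R n]_y (L (euclid_row y))%:E)%E.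
  rewrite /L; under eq_integral => y _ do rewrite EFinM.
  have /andP[phi0 _] := phiC x0.
  rewrite ge0_integralZl//=.
  - by rewrite integral_gaussian.
  - exact: measurable_gaussian.
apply: (laplace_dct e0 phiC mF mL) => [z /phiK/le_psi//|y].
rewrite /L; apply: cvgM.
  apply: (@cvg_scaled _ phi y cphi); near=> N.
  by exists 1; rewrite ?ler01 ?lexx// scale1r.
apply: (@cvg_comp _ _ _ (fun N => N * (psi (x0 + (Num.sqrt N)^-1 *: y) - psi x0)) expR).
  exact: cvg_second_order.
rewrite (_ : - 2^-1 * qform (- hessmx psi x0) y = 2^-1 * qform (hessmx psi x0) y).
  exact: continuous_expR.
by rewrite qformN mulrNN.
Unshelve. all: by end_near. Qed.

End LaplacePoint.

(** This is [laplace_dct] with limit function 0 and centre 0: the gap below [v] on [K] yields both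
    the quadratic bound, through [compact_sqnorm_bound], and the pointwise decay. *)
Lemma laplace_away {R : realType} {n : nat} (phi psi : 'rV[R]_n -> R)
    (K : set 'rV[R]_n) (C v : R) :
  compact K -> (forall x, K x -> {for x, continuous psi}) ->
  (forall x, K x -> psi x < v) ->
  (forall x, 0 <= phi x <= C) -> (forall x, phi x != 0 -> K x) ->
  (forall N, measurable_fun setT
     (fun y : euclid R n => phi (euclid_row y) * expR (N * psi (euclid_row y)))) ->
  Num.sqrt N ^+ n * expR (- (N * v)) *
    integral_rV (fun x => phi x * expR (N * psi x)) @[N --> +oo] --> (0 : R).
Proof.
move=> cK Kpsi Kv phiC phiK mF.
have [d d0 psid] := compact_lt_gap cK Kpsi Kv.
have [B B0 KB] := compact_sqnorm_bound 0 cK.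
have e0 : 0 < d / B by rewrite divr_gt0.
have le_psi z : phi (0 + z) != 0 -> psi (0 + z) <= v - d / B * sqnorm z.
  move=> /phiK Kz; apply: le_trans (psid _ Kz) _; rewrite lerD2l lerN2.
  by rewrite mulrAC ler_pdivrMr// ler_wpM2l ?(ltW d0)// KB.
have mL : measurable_fun setT (fun y : euclid R n => 0 : R) by exact: measurable_cst.
have -> : 0 = fine (\int[lebesgue_euclid R n]_y ((fun=> 0) (euclid_row y))%:E)%E :> R.
  by rewrite integral0.
apply: (@laplace_dct _ _ _ _ _ _ _ _ (fun=> 0) e0 phiC mF mL le_psi) => y.
(* The gap [d] is used a second time: each rescaled integrand is at most C e^(- d N). *)
have lim : C * expR (- (d * N)) @[N --> +oo] --> (0 : R).
  rewrite -[X in _ --> X](mulr0 C); apply: cvgM; first exact: cvg_cst.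
  apply: (@cvg_comp _ _ _ (fun N => d * N) (fun x => expR (- x))); last exact: cvgr_expR.
  by apply: gt0_cvgMry => //; exact: cvg_id.
apply: (squeeze_cvgr _ (cvg_cst 0) lim); near=> N.
have N0 : 0 < N by near: N; exact: nbhs_pinfty_gt.
set x := 0 + _; have /andP[phi0 phileC] := phiC x.
rewrite mulr_ge0 ?expR_ge0//=.
have [->|/phiK/psid le] := eqVneq (phi x) 0.
  by rewrite mul0r mulr_ge0 ?expR_ge0// (le_trans phi0).
rewrite ler_pM ?expR_ge0// ler_expR mulrC -mulNr ler_wpM2r ?(ltW N0)//; lra.
Unshelve. all: by end_near. Qed.

(** * Smooth functions and tangent vectors in charts *)

Section SmoothNear.
Context {R : realType}.

Section SmoothAlgebra.
Context {n : nat}.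
Implicit Types (F G : 'rV[R]_n -> R) (x : 'rV[R]_n).

Lemma smooth_near_continuous F x : smooth_near F x -> {for x, continuous F}.
Proof. by move=> /nbhs_singleton /(_ [::])[]. Qed.

Lemma smooth_near_diff F x : smooth_near F x -> differentiable F x.
Proof. by move=> /smooth_nearP[U [oU Ux CF]]; exact: Ck1_diff oU (CF 1%N) Ux. Qed.

Lemma smooth_near_near F x : smooth_near F x -> \forall y \near x, smooth_near F y.
Proof. by move=> sF; exact: near_join. Qed.

Lemma smooth_near_eq F G x : (\forall y \near x, F y = G y) ->
  smooth_near F x -> smooth_near G x.
Proof.
move=> FG /smooth_nearP[U [oU Ux CF]].
move: FG; rewrite /prop_near1 nbhsE => -[V [oV Vx] VFG].
apply/smooth_nearP; exists (U `&` V); split=> // [|k]; first exact: openI.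
apply: (@eq_Ck _ _ _ _ F); first exact: openI.
  by move=> y [_ /VFG].
by apply: Ck_sub (CF k) => y [].
Qed.

Lemma smooth_near_cst (a : R) x : smooth_near (fun=> a) x.
Proof.
by apply/smooth_nearP; exists setT; split=> //; [exact: openT|move=> k; exact: Ck_cst].
Qed.

Lemma smooth_near_partial F x i : smooth_near F x -> smooth_near (partial i F) x.
Proof.
move=> /smooth_nearP[U [oU Ux CF]]; apply/smooth_nearP; exists U; split=> // k.
exact: Ck_partial (CF k.+1).
Qed.

Lemma smooth_near_pair F G x : smooth_near F x -> smooth_near G x ->
  exists U, [/\ open U, U x, forall k, Ck k U F & forall k, Ck k U G].
Proof.
move=> /smooth_nearP[U [oU Ux CF]] /smooth_nearP[V [oV Vx CG]].
exists (U `&` V); split=> //; first exact: openI.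
  by move=> k; apply: Ck_sub (CF k) => y [].
by move=> k; apply: Ck_sub (CG k) => y [].
Qed.

Lemma smooth_near_mul F G x : smooth_near F x -> smooth_near G x ->
  smooth_near (fun y => F y * G y) x.
Proof.
move=> sF sG; have [U [oU Ux CF CG]] := smooth_near_pair sF sG.
by apply/smooth_nearP; exists U; split=> // k; exact: Ck_mul.
Qed.

Lemma smooth_near_add F G x : smooth_near F x -> smooth_near G x ->
  smooth_near (fun y => F y + G y) x.
Proof.
move=> sF sG; have [U [oU Ux CF CG]] := smooth_near_pair sF sG.
by apply/smooth_nearP; exists U; split=> // k; exact: Ck_add.
Qed.

Lemma smooth_near_sum I (r : seq I) (F : I -> 'rV[R]_n -> R) x :
  (forall i, smooth_near (F i) x) -> smooth_near (fun y => \sum_(i <- r) F i y) x.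
Proof.
move=> sF; elim: r => [|i r IH].
  rewrite (_ : (fun y => _) = fun=> 0); last by apply/funext => y; rewrite big_nil.
  exact: smooth_near_cst.
rewrite (_ : (fun y => _) = fun y => F i y + \sum_(j <- r) F j y).
  exact: (smooth_near_add (sF i) IH).
by apply/funext => y; rewrite big_cons.
Qed.

Lemma is_derive_coord x v i : is_derive x v (fun y : 'rV[R]_n => y 0 i) (v 0 i).
Proof.
have D := @derivable_id R 'rV[R]_n x v.
split; first by have /derivable_mxP := D; exact.
by have := derive_mx D; rewrite derive_id => /rowP/(_ i); rewrite mxE.
Qed.

Lemma smooth_near_coord i x : smooth_near (fun y => y 0 i) x.
Proof.
apply/smooth_nearP; exists setT; split => //; first exact: openT.
have C y : {for y, continuous (fun y : 'rV[R]_n => y 0 i)} by exact: coord_continuous.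
case=> [|k]; split=> // j.
have D y := is_derive_coord y (unit_row j) i.
split; first by move=> y _; have [] := D y.
rewrite (_ : partial j _ = fun=> unit_row j 0 i); first exact: Ck_cst.
by apply/funext => y; have [] := D y.
Qed.

End SmoothAlgebra.

Lemma smooth_near_comp n m (T : 'rV[R]_n -> 'rV[R]_m) (F : 'rV[R]_m -> R) x :
  (forall j, smooth_near (fun y => T y 0 j) x) -> smooth_near F (T x) ->
  smooth_near (F \o T) x.
Proof.
move=> sT /smooth_nearP[V [oV Vx CF]].
have /choice[U HU] (j : 'I_m) : exists U, [/\ open U, U x &
    forall k, Ck k U (fun y => T y 0 j)] by exact/smooth_nearP.
(* [T] is known to be continuous only where all the [U j] meet, so openness of this set is checked
   point by point. *)
pose W := [set y | (forall j, U j y) /\ V (T y)].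
have oW : open W.
  rewrite openE => y [Uy Vy].
  have cT : {for y, continuous T}.
    apply: continuous_at_rV => j; have [_ _ /(_ 0%N) C0] := HU j.
    exact: Ck_continuous C0 (Uy j).
  have n1 : \forall z \near y, forall j, U j z.
    by apply: near_forall => j; have [oU _ _] := HU j; exact: open_nbhs_nbhs.
  have n2 : \forall z \near y, V (T z).
    by apply: cT; exact: open_nbhs_nbhs.
  exact: filterI n1 n2.
apply/smooth_nearP; exists W; split=> //.
  by split=> // j; have [] := HU j.
move=> k; apply: (Ck_comp oW oV) (CF k) => [y []//|j].
by have [_ _ /(_ k)] := HU j; apply: Ck_sub => y [].
Qed.

End SmoothNear.

(** * Coordinate vectors and changes of chart *)

Section Charts.
Context {R : realType} {M : topologicalType} {n : nat}.
Variable A : oriented_atlas R M n.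
Implicit Types (c : chart R M n) (p q : M) (f h : M -> R) (a b : 'rV[R]_n).

Lemma near_cinv c p (P : M -> Prop) : cdom c p -> (\forall q \near p, P q) ->
  \forall x \near cfun c p, P (cinv c x).
Proof.
move=> cp nP; have := cinv_continuous cp.
by apply; rewrite cfunK.
Qed.

Lemma near_cdom c p : cdom c p -> \forall q \near p, cdom c q.
Proof. by move=> cp; apply: open_nbhs_nbhs; split=> //; exact: cdom_open. Qed.

Lemma near_chart c p : cdom c p ->
  \forall x \near cfun c p, cdom c (cinv c x) /\ cfun c (cinv c x) = x.
Proof.
move=> cp; have : \forall x \near cfun c p, (cfun c @` cdom c) x.
  by apply: open_nbhs_nbhs; split; [exact: cran_open|exists p].
by apply: filterS => x [q cq <-]; rewrite cfunK.
Qed.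

Lemma atlas_local_chart c p : atlas A c -> cdom c p -> local_chart A c p.
Proof. by move=> Ac cp; split=> // c' Ac'; exact: (atlas_compatible Ac Ac'). Qed.

Lemma near_local_chart c p : local_chart A c p -> \forall q \near p, local_chart A c q.
Proof. by move=> [cp comp]; apply: near_sub (near_cdom cp) => q cq; split. Qed.

(** Local charts are compatible with the atlas but not by definition with each other, so the
    transition is factored through a chart [c0] of the atlas around [p]. *)
Lemma smooth_transition c c' p : local_chart A c p -> local_chart A c' p ->
  forall i, smooth_near (fun x => transition c c' x 0 i) (cfun c p).
Proof.
move=> [cp comp] [c'p comp'] i; have [c0 Ac0 c0p] := atlas_cover A p.
have s1 j := (comp c0 Ac0 p cp c0p j).1.
have s2 := (comp' c0 Ac0 p c'p c0p i).2.
have E : transition c c0 (cfun c p) = cfun c0 p by rewrite /transition /= cfunK.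
rewrite -E in s2; apply: smooth_near_eq (smooth_near_comp s1 s2).
have : \forall x \near cfun c p, cdom c0 (cinv c x).
  by apply: near_cinv => //; exact: near_cdom.
by apply: filterS => x c0x; rewrite /transition /= cfunK.
Qed.

Lemma transitionE c c' p : cdom c p -> transition c c' (cfun c p) = cfun c' p.
Proof. by move=> cp; rewrite /transition /= cfunK. Qed.

Lemma near_transition h c c' p : cdom c p -> cdom c' p ->
  \forall x \near cfun c' p, ((h \o cinv c) \o transition c' c) x = (h \o cinv c') x.
Proof.
move=> cp c'p; have : \forall x \near cfun c' p, cdom c (cinv c' x).
  by apply: near_cinv => //; exact: near_cdom.
by apply: filterS => x cx; rewrite /transition /= cfunK.
Qed.

(** Brings [smooth_at], which quantifies over all local charts, down to one chart: the others differ
    from it by a smooth transition. *)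
Lemma smooth_at_chart h c p : local_chart A c p ->
  smooth_near (h \o cinv c) (cfun c p) -> smooth_at A h p.
Proof.
move=> cp sh c' c'p; have sT := smooth_transition c'p cp.
rewrite -(transitionE c c'p.1) in sh.
apply: smooth_near_eq (smooth_near_comp sT sh).
exact: near_transition cp.1 c'p.1.
Qed.

Lemma smooth_at_coord c p i : local_chart A c p ->
  smooth_at A (fun q => cfun c q 0 i) p.
Proof.
move=> cp; apply: (smooth_at_chart cp); apply: smooth_near_eq (smooth_near_coord i _).
by apply: filterS (near_chart cp.1) => x [_ /= ->].
Qed.

Lemma near_smooth_at h c p : local_chart A c p -> smooth_at A h p ->
  \forall x \near cfun c p, [/\ local_chart A c (cinv c x), cfun c (cinv c x) = x &
    smooth_at A h (cinv c x)].
Proof.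
move=> cp sh; have n1 := near_chart cp.1.
have n2 := near_cinv cp.1 (near_local_chart cp).
have n3 := smooth_near_near (sh c cp).
have n4 := near_and3 n1 n2 n3.
apply: near_sub n4 => x [[_ E] cx s].
have sx : smooth_at A h (cinv c x) by apply: (smooth_at_chart cx); rewrite E.
exact: And3 cx E sx.
Qed.

Lemma coord_vecE c p a h : local_chart A c p -> smooth_at A h p ->
  coord_vec A c p a h = \sum_i a 0 i * partial i (h \o cinv c) (cfun c p).
Proof.
move=> cp sh; rewrite /coord_vec; case: asboolP => // _.
by rewrite derive_partial//; exact: smooth_near_diff (sh c cp).
Qed.

Lemma coord_vec_linear c p s a b : local_chart A c p ->
  coord_vec A c p (s *: a + b) =
  fun h => s * coord_vec A c p a h + coord_vec A c p b h.
Proof.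
move=> cp; apply/funext => h; have [sh|nsh] := pselect (smooth_at A h p).
  rewrite !coord_vecE// mulr_sumr -big_split /=; apply: eq_bigr => i _.
  by rewrite !mxE mulrDl mulrA.
(* On a function that is not smooth at [p], all three vectors take the default value 0. *)
by rewrite /coord_vec asboolF// mulr0 addr0.
Qed.

(** The coordinate functions read off the components of a tangent vector, which gives injectivity of
    [coord_vec] and access to the components of a vector field. *)
Lemma coord_vec_coord c p a i : local_chart A c p ->
  coord_vec A c p a (fun q => cfun c q 0 i) = a 0 i.
Proof.
move=> cp; rewrite coord_vecE//; last exact: smooth_at_coord.
have E k : partial k ((fun q => cfun c q 0 i) \o cinv c) (cfun c p) = (i == k)%:R.
  rewrite /partial (@near_eq_derive _ _ _ _ (fun y : 'rV[R]_n => y 0 i)).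
    by have [_ ->] := is_derive_coord (cfun c p) (unit_row k) i; rewrite mxE eqxx.
  by apply: filterS (near_chart cp.1) => x [_ /= ->].
rewrite (bigD1 i)//= E eqxx mulr1 big1 ?addr0// => k ki.
by rewrite E eq_sym (negPf ki) mulr0.
Qed.

(** The transpose of the Jacobian matrix for column vectors: components are rows here and are
    multiplied on the right. *)
Definition chart_jac c c' p : 'M[R]_n :=
  \matrix_(i, k) partial i (fun x => transition c c' x 0 k) (cfun c p).

Lemma coord_vec_change c c' p a : local_chart A c p -> local_chart A c' p ->
  coord_vec A c p a = coord_vec A c' p (a *m chart_jac c c' p).
Proof.
move=> cp c'p; apply/funext => h; have [sh|nsh] := pselect (smooth_at A h p); last first.
  by rewrite /coord_vec asboolF.
rewrite coord_vecE// coord_vecE//.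
have sT := smooth_transition cp c'p.
have chain i : partial i (h \o cinv c) (cfun c p) =
    \sum_k chart_jac c c' p i k * partial k (h \o cinv c') (cfun c' p).
  rewrite /partial -(near_eq_derive _ (near_transition h c'p.1 cp.1)).
  have [|k|_ ->] := @is_derive_chain R _ n (h \o cinv c') (transition c c')
    (cfun c p) (unit_row i).
  - by rewrite (transitionE c' cp.1); exact: smooth_near_diff (sh c' c'p).
  - exact: smooth_near_diff (sT k).
  by apply: eq_bigr => k _; rewrite mxE (transitionE c' cp.1).
under eq_bigr => i _ do rewrite chain mulr_sumr.
rewrite exchange_big; apply: eq_bigr => k _; rewrite mxE mulr_suml.
by apply: eq_bigr => i _; rewrite mulrA.
Qed.

Lemma tangent_chart c p X : local_chart A c p -> tangent A p X ->
  exists a, X = coord_vec A c p a.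
Proof.
by move=> cp [c' [a [c'p ->]]]; exists (a *m chart_jac c' c p); exact: coord_vec_change.
Qed.

Lemma tangent_coord_vec c p a : local_chart A c p -> tangent A p (coord_vec A c p a).
Proof. by move=> cp; exists c, a. Qed.

Lemma coord_vec_eq0 c p a : local_chart A c p ->
  coord_vec A c p a = tvec0 -> a = 0.
Proof.
move=> cp a0; apply/rowP => i; rewrite mxE -(coord_vec_coord a i cp) a0.
by [].
Qed.

End Charts.

(** * Hessian and metric in charts *)

Section BilinearForms.
Context {R : realType} {M : topologicalType} {n : nat}.
Variable A : oriented_atlas R M n.
Implicit Types (c : chart R M n) (p : M) (a b : 'rV[R]_n).

(** Tested on all pairs of vectors and not only on the frame, because bilinearity of [hess] is not
    built into its definition and is obtained from this property. *)
Definition represented c p (B : @tvec R M -> @tvec R M -> R) (S : 'M[R]_n) : Prop :=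
  forall a b, B (coord_vec A c p a) (coord_vec A c p b) = (a *m S *m b^T) 0 0.

Lemma form_mx_represented c p B S : represented c p B S -> form_mx A c p B = S.
Proof.
move=> BS; apply/matrixP => i j.
by rewrite mxE /coord_frame BS /unit_row -rowE trmx_delta -colE !mxE.
Qed.

Lemma represented_change c c' p B S : local_chart A c p -> local_chart A c' p ->
  represented c p B S ->
  represented c' p B (chart_jac c' c p *m S *m (chart_jac c' c p)^T).
Proof.
move=> cp c'p BS a b.
by rewrite (coord_vec_change a c'p cp) (coord_vec_change b c'p cp) BS trmx_mul !mulmxA.
Qed.

Lemma linear_form_sum (phi : 'rV[R]_n -> R) :
  (forall s a b, phi (s *: a + b) = s * phi a + phi b) ->
  forall a, phi a = \sum_i a 0 i * phi (unit_row i).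
Proof.
move=> lin a.
have phi0 : phi 0 = 0.
  have := lin 1 0 0; rewrite scaler0 addr0 mul1r => /eqP.
  by rewrite -subr_eq subrr => /eqP.
rewrite {1}(row_sum_delta a).
elim: (index_enum _) => [|i r IH]; first by rewrite !big_nil.
by rewrite !big_cons lin IH.
Qed.

Lemma metric_represented (g : riemannian_metric A) c p : local_chart A c p ->
  represented c p (g p) (form_mx A c p (g p)).
Proof.
move=> cp a b; have T a' := tangent_coord_vec a' cp.
have Ea := @linear_form_sum (fun a => g p (coord_vec A c p a) (coord_vec A c p b)).
rewrite Ea => [|s a1 a2]; last by rewrite coord_vec_linear// metric_linear.
rewrite -mulmxA mxE; apply: eq_bigr => i _; congr (_ * _).
(* [metric_linear] concerns the first argument; symmetry brings the second one there. *)
rewrite Defs.metric_sym//.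
have Eb := @linear_form_sum
  (fun b => g p (coord_vec A c p b) (coord_vec A c p (unit_row i))).
rewrite Eb => [|s b1 b2]; last by rewrite coord_vec_linear// metric_linear.
rewrite mxE; apply: eq_bigr => j _; rewrite !mxE mulrC Defs.metric_sym//.
Qed.

Lemma metric_posdef (g : riemannian_metric A) c p : local_chart A c p ->
  posdef (form_mx A c p (g p)).
Proof.
move=> cp; split.
  apply/matrixP => i j; rewrite !mxE Defs.metric_sym//; exact: tangent_coord_vec.
move=> z z0; rewrite /qform -(metric_represented g cp) metric_gt0//.
  exact: tangent_coord_vec.
by move=> E; move: z0; rewrite (coord_vec_eq0 cp E) eqxx.
Qed.

End BilinearForms.

(** * The intrinsic Hessian and its matrix in a chart *)

Section Hessian.
Context {R : realType} {M : topologicalType} {n : nat}.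
Variable A : oriented_atlas R M n.
Variables (c : chart R M n) (p : M) (f : M -> R).
Hypotheses (cp : local_chart A c p) (sf : smooth_at A f p).
Implicit Types (a b : 'rV[R]_n).

Let F := f \o cinv c.
Let x0 := cfun c p.

Lemma smooth_at_coord_vec a h : smooth_at A h p ->
  smooth_at A (fun q => coord_vec A c q a h) p.
Proof.
move=> sh; apply: (smooth_at_chart cp).
apply: (@smooth_near_eq _ _ (fun x => \sum_i a 0 i * partial i (h \o cinv c) x)).
  apply: near_sub (near_smooth_at cp sh) => x [cx E s].
  by rewrite /= coord_vecE// E.
apply: smooth_near_sum => i; apply: smooth_near_mul; first exact: smooth_near_cst.
exact: smooth_near_partial (sh c cp).
Qed.

Lemma vector_field_coord_vec a : vector_field_near A p (fun q => coord_vec A c q a).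
Proof.
split; last by move=> h; exact: smooth_at_coord_vec.
by apply: near_sub (near_local_chart cp) => q cq; exact: tangent_coord_vec.
Qed.

Hypothesis crit : forall i, partial i F x0 = 0.

(* The derivatives of the components of [Y] do not matter, since they are
   multiplied by the first derivatives of [f], which vanish at [p]. *)
Lemma vector_field_hess a b (Y : M -> @tvec R M) : vector_field_near A p Y ->
  Y p = coord_vec A c p b ->
  coord_vec A c p a (fun q => Y q f) = (a *m hessmx F x0 *m b^T) 0 0.
Proof.
move=> [tY sY] Yp.
(* The components of [Y] in the chart, obtained by applying [Y] to the coordinate functions; they
   are smooth because [Y] preserves smoothness. *)
pose beta k x := Y (cinv c x) (fun q => cfun c q 0 k).
have sbeta k : smooth_near (beta k) x0.
  exact: (sY _ (smooth_at_coord k cp) c cp).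
have sF : smooth_near F x0 by exact: sf cp.
have near_Y : \forall x \near x0,
    \sum_k beta k x * partial k F x = ((fun q => Y q f) \o cinv c) x.
  have n1 := near_smooth_at cp sf.
  have n2 := near_cinv cp.1 tY.
  apply: near_sub (filterI n1 n2) => x [[cx E s] tYx].
  have [d Yd] := tangent_chart cx tYx.
  rewrite /= /beta Yd coord_vecE// E; apply: eq_bigr => k _.
  by rewrite coord_vec_coord.
have beta0 k : beta k x0 = b 0 k.
  by rewrite /beta /x0 (cfunK cp.1) Yp coord_vec_coord.
rewrite (coord_vecE a cp (sY _ sf)).
rewrite -mulmxA mxE; apply: eq_bigr => i _; congr (_ * _).
rewrite /partial -(near_eq_derive _ near_Y).
have D : is_derive x0 (unit_row i) (\sum_(k < n) (beta k * partial k F))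
    (\sum_(k < n) (beta k x0 *: partial i (partial k F) x0 +
                   partial k F x0 *: partial i (beta k) x0)).
  apply: is_derive_sum => k; apply: is_deriveM; apply: DeriveDef => //.
    exact: diff_derivable (smooth_near_diff (sbeta k)).
  exact: diff_derivable (smooth_near_diff (smooth_near_partial k sF)).
have -> : (fun x => \sum_k beta k x * partial k F x) =
          \sum_(k < n) (beta k * partial k F).
  by apply/funext => x; rewrite fct_sumE.
have [_ ->] := D; rewrite mxE; apply: eq_bigr => k _.
by rewrite crit scale0r addr0 beta0 !mxE mulrC.
Qed.

(** All extensions give the same value by [vector_field_hess]. The value selected by [xget] is
    unique because fields with constant components in the chart extend any two tangent vectors. *)
Lemma hess_represented : represented A c p (hess A f p) (hessmx F x0).
Proof.
move=> a b; rewrite /hess; apply: xget_unique.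
  move=> X' Y' _ vY Xp Yp; rewrite Xp; apply/esym; exact: vector_field_hess vY Yp.
move=> r /= Hr; have vX := vector_field_coord_vec a; have vY := vector_field_coord_vec b.
by rewrite (Hr _ _ vX vY erefl erefl); exact: vector_field_hess vY erefl.
Qed.

End Hessian.

(** * Contribution of one chart *)

Section LocalMaximum.
Context {R : realType} {n : nat}.
Variables (F : 'rV[R]_n -> R) (x0 : 'rV[R]_n).
Hypotheses (sF : smooth_near F x0) (maxF : \forall x \near x0, F x <= F x0).

Lemma partial_max i : partial i F x0 = 0.
Proof.
have nd := near_sub (@smooth_near_diff _ _ F) (smooth_near_near sF).
have : \forall x \near x0, differentiable F x /\ F x <= F x0 by exact: filterI nd maxF.
move=> /nbhs_ballP[r /= r0 rB].
pose g (t : R) := F (x0 + t *: unit_row i).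
have in_ball (t : R) : t \in `](- r), r[ -> ball x0 r (x0 + t *: unit_row i).
  rewrite in_itv /= => tr; apply/ball_rVP => // j.
  rewrite !mxE [x0 0 j + _]addrC addrK eqxx /=.
  case: (j == i); rewrite ?mulr1 ?mulr0 ?normr0//.
  by rewrite ltr_norml.
have dg (t : R) : t \in `](- r), r[ ->
    is_derive t 1 g ('D_(unit_row i) F (x0 + t *: unit_row i)).
  move=> /in_ball/rB[dF _]; apply: (is_derive_line F x0 (unit_row i) t _).1.
  by apply: DeriveDef => //; exact: diff_derivable.
have zI : (0 : R) \in `](- r), r[ by rewrite in_itv /= oppr_lt0 r0.
have Dg (t : R) : t \in `](- r), r[ -> derivable g t 1 by move=> /dg[].
have mg (t : R) : t \in `](- r), r[ -> g t <= g 0.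
  by move=> /in_ball/rB[_]; rewrite /g scale0r addr0.
have rr : - r <= r by rewrite ge0_cp ?(ltW r0).
have [_ E] := derive1_at_max rr Dg zI mg.
by have [_] := dg 0 zI; rewrite E scale0r addr0.
Qed.

Lemma hessmx_sym : (hessmx F x0)^T = hessmx F x0.
Proof.
have /smooth_nearP[U [oU Ux CF]] := sF.
by apply/matrixP => i j; rewrite !mxE; exact: schwarz oU (CF 2) Ux.
Qed.

(** The form is the limit in [cvg_second_order], whose terms are nonpositive for large N by
    maximality. *)
Lemma qform_hess_max y : qform (hessmx F x0) y <= 0.
Proof.
have /smooth_nearP[U [oU Ux CF]] := sF.
have cv := @cvg_second_order _ _ F x0 U oU Ux (CF 2) partial_max y.
move: maxF => /nbhs_ballP[r /= r0 rB].
have : 2^-1 * qform (hessmx F x0) y <= 0.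
  apply: (cvgr_to_le cv); have nr := near_scaled y r0; near=> N.
  have [N0 yr] : 0 < N /\ `|(Num.sqrt N)^-1 *: y| < r by near: N.
  rewrite pmulr_rle0// subr_le0; apply: rB.
  by rewrite -ball_normE /ball_ /= opprD addrA subrr add0r normrN.
by rewrite pmulr_rle0// invr_gt0.
Unshelve. all: by end_near. Qed.

End LocalMaximum.

Section ChartIntegral.
Context {R : realType} {M : topologicalType} {n : nat}.
Variables (M_compact : compact [set: M]).
Variables (A : oriented_atlas R M n) (g : riemannian_metric A).
Variables (c : chart R M n) (u f : M -> R).
Hypotheses (Ac : atlas A c) (su : smooth A u) (sf : smooth A f).
Hypotheses (u0 : forall p, 0 <= u p).
Hypothesis supp_u : closure [set p | u p != 0] `<=` cdom c.

Let D : set 'rV[R]_n := cfun c @` cdom c.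
Let K : set 'rV[R]_n := cfun c @` closure [set p | u p != 0].
Let psi := f \o cinv c.

(** The Riemannian density of the chart weighted by [u], free of the orientation sign of
    [volume_form]; the test on [D] is there because [cinv] is arbitrary outside the range. *)
Definition chart_density (x : 'rV[R]_n) : R :=
  if `[< D x >] then
    u (cinv c x) * Num.sqrt (\det (form_mx A c (cinv c x) (g (cinv c x))))
  else 0.

Lemma chart_integralE N :
  chart_integral A c (fun p v => u p * (expR (N * f p) * volume_form g p v)) =
  integral_rV (fun x => chart_density x * expR (N * psi x)).
Proof.
congr (integral_rV _); apply/funext => x; rewrite /chart_density.
case: asboolP => [Dx|_]; last by rewrite mul0r.
rewrite -mulrA; congr (_ * _); rewrite mulrC; congr (_ * _).
(* The coordinate frame of a chart of the atlas is positive, with the identity as its matrix in that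
   chart. *)
rewrite /volume_form asboolT//; exists c, 1%:M.
case: Dx => p cp <-; rewrite (cfunK cp); split; [exact: Ac|exact: cp| |].
  by rewrite det1 ltr01.
by move=> i; rewrite row1.
Qed.

Let KD : K `<=` D. Proof. by move=> _ [p /supp_u cp <-]; exists p. Qed.

Lemma compact_chart_support : compact K.
Proof.
apply: continuous_compact.
  by apply: continuous_in_subspaceT => p; rewrite inE => /supp_u; exact: cfun_continuous.
by apply: (subclosed_compact _ M_compact) => //; exact: closed_closure.
Qed.

Let closed_K : closed K.
Proof. by apply: compact_closed compact_chart_support; exact: norm_hausdorff. Qed.

Let density_out x : ~ K x -> chart_density x = 0.
Proof.
move=> nKx; rewrite /chart_density; case: asboolP => // -[p cp xE].
have [->|up] := eqVneq (u (cinv c x)) 0; first by rewrite mul0r.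
exfalso; apply: nKx; exists p => //; apply: subset_closure => /=.
by move: up; rewrite -xE cfunK.
Qed.

Lemma density_support x : chart_density x != 0 -> K x.
Proof. by move=> /eqP H; apply: contrapT => /density_out. Qed.

Let psi_continuous x : D x -> {for x, continuous psi}.
Proof.
move=> [p cp <-]; apply: smooth_near_continuous; apply: sf => //.
exact: atlas_local_chart.
Qed.

Lemma continuous_psi x : K x -> {for x, continuous psi}.
Proof. by move=> /KD; exact: psi_continuous. Qed.

Let density_continuousD x : D x -> {for x, continuous chart_density}.
Proof.
move=> Dx; have [p cp xE] := Dx.
have lcp := atlas_local_chart Ac cp.
apply: (@near_eq_continuous_at _ _ (fun x =>
    u (cinv c x) * Num.sqrt (\det (form_mx A c (cinv c x) (g (cinv c x)))))).
  have : \forall y \near x, D y by apply: open_nbhs_nbhs; split=> //; exact: cran_open.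
  by apply: near_sub => y Dy; rewrite /chart_density asboolT.
apply: continuous_atM.
  by rewrite -xE; apply: smooth_near_continuous (su lcp).
apply: (@continuous_comp _ _ _ (fun x => \det (form_mx A c (cinv c x) (g (cinv c x)))));
  last exact: sqrt_continuous.
apply: continuous_det => i j; rewrite -xE.
rewrite (_ : (fun y => _) = (fun q => g q (coord_frame A c q i) (coord_frame A c q j))
    \o cinv c); last by apply/funext => y; rewrite mxE.
exact: smooth_near_continuous (metric_smooth g i j lcp lcp).
Qed.

Lemma continuous_chart_density : continuous chart_density.
Proof.
apply: continuous_open_closed closed_K KD density_continuousD density_out.
exact: cran_open.
Qed.

Lemma chart_density_bound : exists C, forall x, 0 <= chart_density x <= C.
Proof.
have d0 x : 0 <= chart_density x.
  by rewrite /chart_density; case: asboolP => // _; rewrite mulr_ge0 ?sqrtr_ge0.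
have [K0|/set0P K0] := eqVneq K set0.
  by exists 0 => x; rewrite density_out ?lexx// K0.
have [y yK ymax] := EVT_max_rV K0 compact_chart_support
  (continuous_subspaceT continuous_chart_density).
exists (chart_density y) => x; rewrite d0 /=.
have [Kx|/density_out->] := pselect (K x); last exact: d0.
by apply: ymax; rewrite inE.
Qed.

(** [psi] may be wild outside [D], so it is the product that is shown to be continuous: the density
    vanishes off [K], which lies in [D]. *)
Lemma measurable_density N : measurable_fun setT
  (fun y : euclid R n => chart_density (euclid_row y) * expR (N * psi (euclid_row y))).
Proof.
apply: (@measurable_continuous_euclid R n (fun x => chart_density x * expR (N * psi x))).
apply: continuous_open_closed closed_K KD _ _; first exact: cran_open.
  move=> x Dx; apply: continuous_atM; first exact: continuous_chart_density.
  apply: (@continuous_comp _ _ _ (fun x => N * psi x) expR); last exact: continuous_expR.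
  by apply: continuous_atM; [exact: continuous_at_cst|exact: psi_continuous].
by move=> x /density_out ->; rewrite mul0r.
Qed.

End ChartIntegral.

Lemma sqrtr_exp (R : rcfType) (x : R) n : 0 <= x ->
  Num.sqrt (x ^+ n) = Num.sqrt x ^+ n.
Proof.
by move=> x0; elim: n => [|n IH]; rewrite ?expr0 ?sqrtr1// !exprS sqrtrM// IH.
Qed.

(** * Definiteness at the maximum and independence of the chart *)

Section ManifoldMaximum.
Context {R : realType} {M : topologicalType} {n : nat}.
Variables (M_compact : compact [set: M]).
Variables (A : oriented_atlas R M n) (g : riemannian_metric A).
Variables (f : M -> R) (p0 : M).
Hypotheses (f_smooth : smooth A f) (f_max : forall p, p <> p0 -> f p < f p0).
Hypothesis f_nondegenerate : nondegenerate_at A p0 (hess A f p0).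

Lemma le_max p : f p <= f p0.
Proof. by have [->//|/f_max/ltW] := pselect (p = p0). Qed.

Section Chart.
Variables (c : chart R M n) (c_p0 : local_chart A c p0).
Let F := f \o cinv c.
Let x0 := cfun c p0.

Let sF : smooth_near F x0. Proof. exact: f_smooth. Qed.

Let maxF : \forall x \near x0, F x <= F x0.
Proof. by apply: near_all => x; rewrite /F /x0 /= (cfunK c_p0.1); exact: le_max. Qed.

Lemma hess_max_represented : represented A c p0 (hess A f p0) (hessmx F x0).
Proof.
by apply: hess_represented; [|exact: f_smooth|move=> i; exact: partial_max].
Qed.

(** Maximality gives semidefiniteness. A vector in the kernel of the matrix is a tangent vector on
    which [hess] vanishes identically, hence zero by nondegeneracy. *)
Lemma hess_max_posdef : posdef (- hessmx F x0).
Proof.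
apply: semidef_posdef.
- by rewrite linearN /= hessmx_sym.
- by move=> z; rewrite qformN oppr_ge0; exact: qform_hess_max.
move=> z; rewrite mulmxN => /eqP; rewrite oppr_eq0 => /eqP zH.
apply: (coord_vec_eq0 c_p0); apply: f_nondegenerate.
  exact: tangent_coord_vec.
move=> Y /(tangent_chart c_p0)[b ->].
by rewrite hess_max_represented zH mul0mx mxE.
Qed.

End Chart.

Variables (c : chart R M n) (c_p0 : local_chart A c p0).
Let H := form_mx A c p0 (hess A f p0).
Let G := form_mx A c p0 (g p0).

Lemma form_hess_max : H = hessmx (f \o cinv c) (cfun c p0).
Proof. exact: form_mx_represented (hess_max_represented c_p0). Qed.

Lemma det_hess_gt0 : 0 < \det (- H).
Proof. by rewrite form_hess_max; exact/posdef_det_gt0/hess_max_posdef. Qed.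

Lemma det_metric_gt0 : 0 < \det G.
Proof. exact/posdef_det_gt0/metric_posdef. Qed.

(** Both matrices change by congruence with the same [J], so the factor det J ^ 2 cancels in the
    quotient. *)
Lemma density_ratio_change c' : local_chart A c' p0 ->
  Num.sqrt (\det (form_mx A c' p0 (g p0))) *
    Num.sqrt ((2 * pi) ^+ n / \det (- hessmx (f \o cinv c') (cfun c' p0))) =
  Num.sqrt ((2 * pi) ^+ n) * (Num.sqrt (\det G) / Num.sqrt (\det (- H))).
Proof.
move=> c'p0; pose J := chart_jac c' c p0.
have GE : form_mx A c' p0 (g p0) = J *m G *m J^T.
  apply: form_mx_represented; apply: represented_change => //.
  exact: metric_represented.
have HE : hessmx (f \o cinv c') (cfun c' p0) = J *m H *m J^T.
  rewrite -(form_mx_represented (hess_max_represented c'p0)).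
  apply: form_mx_represented; apply: represented_change c_p0 c'p0 _.
  by rewrite form_hess_max; exact: hess_max_represented.
have G'0 := posdef_det_gt0 (metric_posdef g c'p0).
have dG : \det (J *m G *m J^T) = \det J ^+ 2 * \det G.
  by rewrite !det_mulmx det_tr; ring.
have dH : \det (- (J *m H *m J^T)) = \det J ^+ 2 * \det (- H).
  by rewrite -mulNmx -mulmxN !det_mulmx det_tr; ring.
(* Invertibility of [J] is read off from the metric, whose determinant is positive in both
   charts. *)
have J0 : 0 < \det J ^+ 2.
  by move: G'0; rewrite GE dG pmulr_lgt0//; exact: det_metric_gt0.
have H0 := det_hess_gt0; have G0 := det_metric_gt0.
have s1 (x y : R) : 0 <= x -> 0 <= y -> Num.sqrt (x / y) = Num.sqrt x / Num.sqrt y.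
  by move=> x0 y0; rewrite sqrtrM// sqrtrV.
have P0 : 0 <= (2 * pi) ^+ n :> R by rewrite exprn_ge0// mulr_ge0// pi_ge0.
rewrite GE HE dG dH s1 ?(mulr_ge0 (ltW J0) (ltW H0))//.
rewrite (sqrtrM (\det G) (ltW J0)) (sqrtrM (\det (- H)) (ltW J0)).
have sJ : Num.sqrt (\det J ^+ 2) != 0 by rewrite gt_eqF// sqrtr_gt0.
have sH : Num.sqrt (\det (- H)) != 0 by rewrite gt_eqF// sqrtr_gt0.
move: (Num.sqrt (\det J ^+ 2)) (Num.sqrt (\det (- H))) sJ sH => a b a0 b0.
by field; rewrite a0 b0.
Qed.

(** [c'] runs over the charts of the partition of unity while [c] stays fixed, so that all
    contributions carry the same factor and can be summed. *)
Lemma chart_integral_asymptotics c' (u : M -> R) :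
  atlas A c' -> smooth A u -> (forall p, 0 <= u p) ->
  closure [set p | u p != 0] `<=` cdom c' ->
  Num.sqrt N ^+ n * expR (- (N * f p0)) *
    chart_integral A c' (fun p v => u p * (expR (N * f p) * volume_form g p v))
    @[N --> +oo] -->
  u p0 * (Num.sqrt ((2 * pi) ^+ n) * (Num.sqrt (\det G) / Num.sqrt (\det (- H)))).
Proof.
move=> Ac' su u0 supp_u.
under eq_cvg => N do rewrite (chart_integralE g u f Ac' N).
have cK := compact_chart_support M_compact supp_u.
have Kpsi := continuous_psi Ac' f_smooth supp_u.
have [C phiC] := chart_density_bound M_compact g Ac' su u0 supp_u.
have mF := measurable_density M_compact g Ac' su f_smooth supp_u.
have phiK := @density_support _ _ _ A g c' u.
have [c'p0|nc'p0] := pselect (cdom c' p0); last first.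
  (* The support of [u] lies inside the chart, so a point outside the chart is a zero of [u] and the
     limit to be proved is 0. *)
  have -> : u p0 = 0.
    apply: contrapT => /eqP up0; apply: nc'p0; apply: supp_u.
    exact: subset_closure.
  rewrite mul0r; apply: (laplace_away cK Kpsi _ phiC phiK mF).
  move=> _ [p cp <-] /=; have c'p := supp_u _ cp; rewrite cfunK//.
  by apply: f_max => E; apply: nc'p0; rewrite -E.
have lc' := atlas_local_chart Ac' c'p0.
have Fp0 : (f \o cinv c') (cfun c' p0) = f p0 by rewrite /= cfunK.
have /smooth_nearP[U [oU Ux CF]] := f_smooth lc'.
have crit i : partial i (f \o cinv c') (cfun c' p0) = 0.
  apply: partial_max; first exact: f_smooth.
  by apply: near_all => x; rewrite Fp0; exact: le_max.
have cphi : {for cfun c' p0, continuous (chart_density g c' u)}.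
  exact: (continuous_chart_density M_compact Ac' su supp_u).
have Kmax x : (cfun c' @` closure [set p | u p != 0]) x -> x <> cfun c' p0 ->
    (f \o cinv c') x < (f \o cinv c') (cfun c' p0).
  move=> [p cp <-] xn; have c'p := supp_u _ cp; rewrite Fp0 /= cfunK//.
  by apply: f_max => E; apply: xn; rewrite E.
have := laplace_at_max oU Ux (CF 2) crit (hess_max_posdef lc') cK Kpsi Kmax
  phiC phiK cphi mF.
rewrite Fp0 /chart_density asboolT; last by exists p0.
by rewrite cfunK// -mulrA (density_ratio_change lc').
Qed.

End ManifoldMaximum.

Theorem theorem1 (R : realType) (M : topologicalType) (n : nat)
    (M_compact : compact [set: M]) (M_hausdorff : hausdorff_space M)
    (A : oriented_atlas R M n) (g : riemannian_metric A)
    (P : partition_of_unity A)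
    (f : M -> R) (p0 : M)
    (f_smooth : smooth A f)
    (f_max : forall p, p <> p0 -> f p < f p0)
    (f_nondegenerate : nondegenerate_at A p0 (hess A f p0))
    (c : chart R M n) (c_p0 : local_chart A c p0) :
  let H : 'M[R]_n := form_mx A c p0 (hess A f p0) in
  let G : 'M[R]_n := form_mx A c p0 (g p0) in
  let Ric : 'M[R]_n := ricci_mx g c p0 in
  let trHR : R := \sum_i \sum_j invmx H i j * Ric i j in
  form_integral P (fun p v => expR (N * f p) * volume_form g p v) /
    ((2 * pi / N) `^ (n%:R / 2) * expR (N * f p0) *
     (Num.sqrt (\det G) / Num.sqrt (\det (- H))) *
     (1 + (6 * N)^-1 * trHR)) @[N --> +oo] --> (1 : R).
Proof.
move=> H G Ric trHR.
pose Q : R := Num.sqrt (\det G) / Num.sqrt (\det (- H)).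
have Q0 : Q != 0.
  by rewrite mulf_neq0 ?invr_eq0// gt_eqF// sqrtr_gt0;
    [exact: det_metric_gt0|exact: det_hess_gt0].
pose P2 : R := Num.sqrt ((2 * pi) ^+ n).
have P20 : P2 != 0 by rewrite gt_eqF// sqrtr_gt0 exprn_gt0// mulr_gt0// pi_gt0.
have num : Num.sqrt N ^+ n * expR (- (N * f p0)) *
    form_integral P (fun p v => expR (N * f p) * volume_form g p v)
    @[N --> +oo] --> P2 * Q.
  have -> : P2 * Q = \sum_(i < pu_size P) pu_fun i p0 * (P2 * Q).
    by rewrite -mulr_suml pu_fun_sum1 mul1r.
  under eq_cvg => N do rewrite mulr_sumr.
  apply: cvg_bigsum => i _.
  apply: (@chart_integral_asymptotics R M n M_compact A g f p0 f_smooth f_max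
    f_nondegenerate c c_p0 (pu_chart i) (pu_fun i)).
  - exact: pu_chart_atlas.
  - exact: pu_fun_smooth.
  - exact: pu_fun_ge0.
  - exact: pu_fun_support.
have corr : 1 + (6 * N)^-1 * trHR @[N --> +oo] --> (1 : R).
  rewrite -[X in _ --> X]addr0 -(mul0r trHR).
  apply: cvgD; first exact: cvg_cst.
  apply: cvgM; last exact: cvg_cst.
  apply/gtr0_cvgV0.
    by near=> N; rewrite mulr_gt0//; near: N; exact: nbhs_pinfty_gt.
  by apply: gt0_cvgMry => //; exact: cvg_id.
have PQ0 : P2 * Q != 0 by exact: mulf_neq0.
have lim : Num.sqrt N ^+ n * expR (- (N * f p0)) *
      form_integral P (fun p v => expR (N * f p) * volume_form g p v) *
    (P2 * Q * (1 + (6 * N)^-1 * trHR))^-1 @[N --> +oo] --> (1 : R).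
  rewrite [X in _ --> X](_ : 1 = P2 * Q * (P2 * Q * 1)^-1); last by rewrite mulr1 divff.
  apply: cvgM; first exact: num.
  apply: cvgV; first by rewrite mulr1.
  by apply: cvgM; [exact: cvg_cst|exact: corr].
(* The quotient of the statement agrees with the one in [lim] only for N > 0, where the real power
   splits into square roots; agreement near infinity is enough. *)
move: lim; apply: cvg_trans; apply: near_eq_cvg; near=> N.
have N0 : 0 < N by near: N; exact: nbhs_pinfty_gt.
have powE : (2 * pi / N) `^ (n%:R / 2) = P2 / Num.sqrt N ^+ n.
  have N2 : 0 <= 2 * pi / N by rewrite divr_ge0 ?mulr_ge0 ?pi_ge0 ?(ltW N0).
  rewrite powRrM powR_mulrn// powR12_sqrt ?exprn_ge0//.
  rewrite exprMn exprVn sqrtrM ?exprn_ge0 ?mulr_ge0 ?pi_ge0//.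
  rewrite sqrtrV ?exprn_ge0 ?(ltW N0)//; congr (_ / _).
  exact: sqrtr_exp (ltW N0).
rewrite powE expRN -/Q !invfM !invrK; ring.
Unshelve. all: by end_near. Qed.
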